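(* Let $k$ be a commutative ring and let $A\,|\,B$ be an algebra extension, i.e. an identity-preserving homomorphism of $k$-algebras $B\to A$. Then the following are equivalent: (i) $A\,|\,B$ is right depth two and right balanced; (ii) there exist a $k$-algebra $R$ and a right $R$-bialgebroid $T$ that is projective as a left $R$-module such that $A\,|\,B$ is a right $T$-Galois extension.
   Context: Algebras are unital associative algebras over a commutative ring $k$. $A$ is viewed as a bimodule over $A$ and $B$ via $B\to A$. Right depth two (right D2): for some (possibly infinite) set $I$, $A\otimes_B A$ is isomorphic, as a natural $A$-$B$-bimodule, to a direct summand of the direct sum $A^{(I)}$ of copies of $A$. Right balanced: with $E=\mathrm{End}(A_B)$ acting on the left of $A$, the natural map $\rho: B\to \mathrm{End}({}_EA)$, $\rho(b)(x)=xb$, is surjective. Right $R$-bialgebroid $T$: a $k$-algebra $T$ with an algebra homomorphism $s_R:R\to T$ and an algebra anti-homomorphism $t_R:R\to T$ with $s_R(r)t_R(s)=t_R(s)s_R(r)$ for all $r,s\in R$; $T$ is made an $R$-$R$-bimodule by $r\cdot t\cdot s=t\,t_R(r)s_R(s)$; and there are $R$-$R$-bimodule maps $\Delta:T\to T\otimes_RT$, $\Delta(t)=t_{(1)}\otimes_R t_{(2)}$, and $\varepsilon:T\to R$ making $T$ a coassociative counital $R$-coring, such that $\Delta(1)=1\otimes_R1$, $\varepsilon(1_T)=1_R$, $s_R(r)t_{(1)}\otimes_R t_{(2)}=t_{(1)}\otimes_R t_R(r)t_{(2)}$, $\Delta(tu)=t_{(1)}u_{(1)}\otimes_R t_{(2)}u_{(2)}$,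 and $\varepsilon(tu)=\varepsilon(s_R(\varepsilon(t))u)=\varepsilon(t_R(\varepsilon(t))u)$ for all $r\in R$, $t,u\in T$. ''Left projective'' means ${}_RT$ is projective, with $r\cdot t=t\,t_R(r)$. Right $T$-comodule algebra: an algebra $A$ with an algebra homomorphism $R\to A$ (making $A$ an $R$-$R$-bimodule) and a map $\delta:A\to A\otimes_RT$, $\delta(a)=a_{(0)}\otimes_R a_{(1)}$, such that: $\delta$ is right $R$-linear, i.e. $\delta(ar)=a_{(0)}\otimes_R a_{(1)}s_R(r)$; $a_{(0)}\varepsilon(a_{(1)})=a$; $(\mathrm{id}_A\otimes\Delta)\circ\delta=(\delta\otimes\mathrm{id}_T)\circ\delta$; $\delta(1_A)=1_A\otimes1_T$; $ra_{(0)}\otimes_Ra_{(1)}=a_{(0)}\otimes_R t_R(r)a_{(1)}$ for all $r\in R,a\in A$; and $\delta(xy)=x_{(0)}y_{(0)}\otimes_R x_{(1)}y_{(1)}$ for all $x,y\in A$. Its subalgebra of coinvariants is $A^{\mathrm{co}\,T}=\{x\in A:\delta(x)=x\otimes_R1_T\}$. $A\,|\,B$ is right $T$-Galois if $A$ is a right $T$-comodule algebra, $A^{\mathrm{co}\,T}$ equals $B$ (i.e. the image of $B$ in $A$), and the canonical map $\beta:A\otimes_BA\to A\otimes_RT$, $\beta(x\otimes y)=xy_{(0)}\otimes y_{(1)}$, is bijective. *)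

(* Defs.v *)
From HB Require Import structures.
From mathcomp Require Import all_boot all_order all_algebra.
From mathcomp Require Import finmap boolp.
From mathcomp Require Import monalg.

Set Implicit Arguments.
Unset Strict Implicit.
Unset Printing Implicit Defensive.

Import GRing.Theory.
Local Open Scope ring_scope.

#[local] Obligation Tactic := idtac.

(* MathComp's algType forces 1 != 0, whereas the zero algebra is       *)
(* allowed here.  An algebra over k is therefore a pzRingType with a   *)
(* ring homomorphism from k to its centre, c *: a being in_alg c * a.  *)

Record kalgebra (k : comPzRingType) := KAlgebra {
  kalg_sort :> pzRingType;
  in_alg : {rmorphism k -> kalg_sort};
  in_alg_central : forall c a, in_alg c * a = a * in_alg c
}.

(* The k-linearity of a multiplicative or anti-multiplicative unital map. *)
Definition over_base (k : comPzRingType) (A B : kalgebra k) (f : A -> B) :=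
  forall c, f (in_alg A c) = in_alg B c.

(* Bimodules over (noncommutative) rings.  The actions are fields of a *)
(* record because one abelian group carries several of them at once.   *)
(* When R and S are k-algebras, every bimodule used below is k-central *)
(* by construction.                                                    *)

Reserved Notation "r *:l m" (at level 40, left associativity).
Reserved Notation "m *:r s" (at level 40, left associativity).
Reserved Notation "m ⊗ n" (at level 40, left associativity).

Record bimodule (R S : pzRingType) := Bimodule {
  bimod_sort :> zmodType;
  lact : R -> bimod_sort -> bimod_sort;
  ract : bimod_sort -> S -> bimod_sort;
  lactDr : forall r, {morph lact r : m n / m + n};
  lactDl : forall m, {morph lact^~ m : r s / r + s};
  lact1 : forall m, lact 1 m = m;
  lactA : forall r s m, lact (r * s) m = lact r (lact s m);
  ractDl : forall s, {morph ract^~ s : m n / m + n};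
  ractDr : forall m, {morph ract m : r s / r + s};
  ract1 : forall m, ract m 1 = m;
  ractA : forall m r s, ract m (r * s) = ract (ract m r) s;
  lractA : forall r m s, ract (lact r m) s = lact r (ract m s)
}.

Notation "r *:l m" := (lact r m) : ring_scope.
Notation "m *:r s" := (ract m s) : ring_scope.

Definition bimod_hom (R S : pzRingType) (M N : bimodule R S) (f : M -> N) :=
  [/\ {morph f : m n / m + n},
      forall r m, f (r *:l m) = r *:l f m
    & forall m s, f (m *:r s) = f m *:r s].

Section RingBimodule.
Variables (A R S : pzRingType) (f : {rmorphism R -> A}) (g : {rmorphism S -> A}).

Program Definition ring_bimod : bimodule R S :=
  @Bimodule R S A (fun r a => f r * a) (fun a s => a * g s)
    _ _ _ _ _ _ _ _ _.
Next Obligation. by move=> r a b /=; rewrite mulrDr. Qed.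
Next Obligation. by move=> a r s /=; rewrite rmorphD mulrDl. Qed.
Next Obligation. by move=> a /=; rewrite rmorph1 mul1r. Qed.
Next Obligation. by move=> r s a /=; rewrite rmorphM mulrA. Qed.
Next Obligation. by move=> s a b /=; rewrite mulrDl. Qed.
Next Obligation. by move=> a r s /=; rewrite rmorphD mulrDr. Qed.
Next Obligation. by move=> a /=; rewrite rmorph1 mulr1. Qed.
Next Obligation. by move=> a r s /=; rewrite rmorphM mulrA. Qed.
Next Obligation. by move=> r a s /=; rewrite mulrA. Qed.
End RingBimodule.

Definition regular_bimod (R : pzRingType) : bimodule R R :=
  ring_bimod (@idfun R) (@idfun R).

Section Biproduct.
Variables (R S : pzRingType) (M N : bimodule R S).

Program Definition bimod_prod : bimodule R S :=
  @Bimodule R S (M * N)%type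
    (fun r x => (r *:l x.1, r *:l x.2)) (fun x s => (x.1 *:r s, x.2 *:r s))
    _ _ _ _ _ _ _ _ _.
Next Obligation. by move=> r [a b] [c d]; rewrite /= !lactDr. Qed.
Next Obligation. by move=> [a b] r s; rewrite /= !lactDl. Qed.
Next Obligation. by move=> [a b]; rewrite /= !lact1. Qed.
Next Obligation. by move=> r s [a b]; rewrite /= !lactA. Qed.
Next Obligation. by move=> r [a b] [c d]; rewrite /= !ractDl. Qed.
Next Obligation. by move=> [a b] r s; rewrite /= !ractDr. Qed.
Next Obligation. by move=> [a b]; rewrite /= !ract1. Qed.
Next Obligation. by move=> [a b] r s; rewrite /= !ractA. Qed.
Next Obligation. by move=> r [a b] s; rewrite /= !lractA. Qed.
End Biproduct.

Section Copower.
Variables (R S : pzRingType) (I : choiceType) (M : bimodule R S).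

Lemma lact0 r : r *:l (0 : M) = 0.
Proof. by apply: (addrI (r *:l (0 : M))); rewrite -lactDr !addr0. Qed.

Lemma ract0 s : (0 : M) *:r s = 0.
Proof. by apply: (addrI ((0 : M) *:r s)); rewrite -ractDl !addr0. Qed.

Definition copow_lact (r : R) (g : {malg M[I]}) : {malg M[I]} :=
  [malg i in msupp g => r *:l g@_i].
Definition copow_ract (g : {malg M[I]}) (s : S) : {malg M[I]} :=
  [malg i in msupp g => g@_i *:r s].

Lemma copow_lactE r g i : (copow_lact r g)@_i = r *:l g@_i.
Proof. by rewrite mcoeffE; case: msuppP; rewrite ?lact0. Qed.
Lemma copow_ractE g s i : (copow_ract g s)@_i = g@_i *:r s.
Proof. by rewrite mcoeffE; case: msuppP; rewrite ?ract0. Qed.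

Let cE := (copow_lactE, copow_ractE, @mcoeffD I M).

(* The direct sum M^(I): families (m_i) of finite support. *)
Program Definition bimod_copow : bimodule R S :=
  @Bimodule R S {malg M[I]} copow_lact copow_ract _ _ _ _ _ _ _ _ _.
Next Obligation. by move=> r g h; apply/malgP => i /=; rewrite !cE lactDr. Qed.
Next Obligation. by move=> g r s; apply/malgP => i /=; rewrite !cE lactDl. Qed.
Next Obligation. by move=> g; apply/malgP => i /=; rewrite !cE lact1. Qed.
Next Obligation. by move=> r s g; apply/malgP => i /=; rewrite !cE lactA. Qed.
Next Obligation. by move=> s g h; apply/malgP => i /=; rewrite !cE ractDl. Qed.
Next Obligation. by move=> g r s; apply/malgP => i /=; rewrite !cE ractDr. Qed.
Next Obligation. by move=> g; apply/malgP => i /=; rewrite !cE ract1. Qed.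
Next Obligation. by move=> g r s; apply/malgP => i /=; rewrite !cE ractA. Qed.
Next Obligation. by move=> r g s; apply/malgP => i /=; rewrite !cE lractA. Qed.
End Copower.

Definition iso_direct_summand (R S : pzRingType) (M N : bimodule R S) : Prop :=
  exists (C : bimodule R S) (phi : bimod_prod M C -> N),
    bimod_hom phi /\ bijective phi.

Definition left_linear (R S : pzRingType) (M : bimodule R S) (X : lmodType R)
    (f : M -> X) :=
  {morph f : m n / m + n} /\ forall r m, f (r *:l m) = r *: f m.

Definition left_projective (R S : pzRingType) (M : bimodule R S) : Prop :=
  forall (X Y : lmodType R) (p : {linear X -> Y}) (f : M -> Y),
    (forall y, exists x, p x = y) -> left_linear f ->
    exists h : M -> X, left_linear h /\ forall m, p (h m) = f m.

(* Tensor product over a noncommutative ring: the free abelian group   *)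
(* on M * N modulo the subgroup generated by the usual relators.       *)

(* Prevents unification from unfolding pure tensors and induced maps. *)
Fact tensor_key : unit. Proof. exact: tt. Qed.

Section Tensor.
Variables (R S U : pzRingType) (M : bimodule R S) (N : bimodule S U).

Notation free := {malg int[(M * N)%type]}.

Inductive tensor_null : free -> Prop :=
| tnull_addl m m' n : tensor_null (<<(m + m', n)>> - << (m, n) >> - <<(m', n)>>)
| tnull_addr m n n' : tensor_null (<<(m, n + n')>> - << (m, n) >> - <<(m, n')>>)
| tnull_bal m s n : tensor_null (<<(m *:r s, n)>> - <<(m, s *:l n)>>)
| tnull_0 : tensor_null 0
| tnull_B x y : tensor_null x -> tensor_null y -> tensor_null (x - y).

Definition tensor_nullb (x : free) : bool := `[< tensor_null x >].

Lemma tensor_null_closed : zmod_closed tensor_nullb.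
Proof.
split=> [|x y]; first exact/asboolP/tnull_0.
by move=> /asboolP x0 /asboolP y0; apply/asboolP/tnull_B.
Qed.

HB.instance Definition _ :=
  GRing.isZmodClosed.Build free tensor_nullb tensor_null_closed.

Definition tensor_relators : zmodClosed free :=
  GRing.ZmodClosed.clone free tensor_nullb _.

Definition tensor_zmod : zmodType := Quotient.quot tensor_relators.

Definition tens : M -> N -> tensor_zmod := locked_with tensor_key
  (fun m n => \pi_(Quotient.quot tensor_relators)%qT << (m, n) >>).

Lemma tens_pi m n :
  tens m n = \pi_(Quotient.quot tensor_relators)%qT << (m, n) >>.
Proof. by rewrite /tens unlock. Qed.

Definition balanced (P : zmodType) (f : M -> N -> P) :=
  [/\ forall n, {morph f^~ n : m m' / m + m'},
      forall m, {morph f m : n n' / n + n'}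
    & forall m s n, f (m *:r s) n = f m (s *:l n)].

(* The map induced by f on the tensor product.  It is total: it is     *)
(* the expected homomorphism when f is balanced (tlift_tens, tliftD),  *)
(* and is only used for such f.                                        *)
Definition flift (P : zmodType) (f : M -> N -> P) (x : free) : P :=
  \sum_(p <- msupp x) f p.1 p.2 *~ x@_p.

Definition tlift (P : zmodType) (f : M -> N -> P) : tensor_zmod -> P :=
  locked_with tensor_key
    (fun u => flift f (repr (u : Quotient.quot tensor_relators))).

Lemma tlift_repr (P : zmodType) (f : M -> N -> P) (u : tensor_zmod) :
  tlift f u = flift f (repr (u : Quotient.quot tensor_relators)).
Proof. by rewrite /tlift unlock. Qed.

Lemma fliftE (P : zmodType) (f : M -> N -> P) (x : free) (D : {fset (M * N)%type}) :
  (msupp x `<=` D)%fset -> flift f x = \sum_(p <- D) f p.1 p.2 *~ x@_p.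
Proof.
move=> sxD; rewrite /flift (big_fset_incl _ sxD) //= => p _.
by rewrite -mcoeff_eq0 => /eqP->; rewrite mulr0z.
Qed.

Lemma fliftB (P : zmodType) (f : M -> N -> P) :
  {morph flift f : x y / x - y}.
Proof.
move=> x y; pose D := (msupp x `|` msupp y)%fset.
rewrite (@fliftE _ f (x - y) D); last exact: msuppB_le.
rewrite (@fliftE _ f x D) ?fsubsetUl // (@fliftE _ f y D) ?fsubsetUr //.
rewrite -sumrB; apply: eq_bigr => p _.
by rewrite mcoeffB mulrzBr.
Qed.

Lemma flift0 (P : zmodType) (f : M -> N -> P) : flift f 0 = 0.
Proof. by rewrite /flift msupp0 big_seq_fset0. Qed.

Lemma fliftU (P : zmodType) (f : M -> N -> P) p : flift f << p >> = f p.1 p.2.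
Proof. by rewrite (fliftE f msuppU_le) big_seq_fset1 mcoeffUU. Qed.

Lemma flift_null (P : zmodType) (f : M -> N -> P) x :
  balanced f -> tensor_null x -> flift f x = 0.
Proof.
case=> fDl fDr fb; elim=> {x} [m m' n|m n n'|m s n||x y _ IHx _ IHy].
- by rewrite !fliftB !fliftU fDl /= addrAC addrK subrr.
- by rewrite !fliftB !fliftU fDr /= addrAC addrK subrr.
- by rewrite fliftB !fliftU /= fb subrr.
- exact: flift0.
- by rewrite fliftB IHx IHy subrr.
Qed.

Lemma pi_eqP (x y : free) :
  \pi_(Quotient.quot tensor_relators)%qT x = \pi_(Quotient.quot tensor_relators)%qT y
    <-> tensor_null (x - y).
Proof.
have -> : tensor_null (x - y) <-> (x - y) \in tensor_relators.
  by split=> /asboolP.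
by rewrite Quotient.idealrBE; split=> /eqP.
Qed.

Lemma tlift_pi (P : zmodType) (f : M -> N -> P) x : balanced f ->
  tlift f (\pi_(Quotient.quot tensor_relators)%qT x) = flift f x.
Proof.
move=> fb; apply/eqP; rewrite tlift_repr -subr_eq0 -fliftB; apply/eqP/flift_null => //.
by apply/pi_eqP; rewrite reprK.
Qed.

Lemma tlift_tens (P : zmodType) (f : M -> N -> P) m n :
  balanced f -> tlift f (tens m n) = f m n.
Proof. by move=> fb; rewrite tens_pi tlift_pi // fliftU. Qed.

Lemma tliftB (P : zmodType) (f : M -> N -> P) :
  balanced f -> {morph tlift f : u v / u - v}.
Proof.
move=> fb u v; rewrite -[u in LHS]reprK -[v in LHS]reprK -raddfB.
by rewrite tlift_pi // fliftB !tlift_repr.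
Qed.

Lemma tliftD (P : zmodType) (f : M -> N -> P) :
  balanced f -> {morph tlift f : u v / u + v}.
Proof.
move=> fb u v; have t0 : tlift f 0 = 0 by rewrite -(subrr 0) tliftB ?subrr.
by rewrite -[v in LHS]opprK tliftB // -[- v]add0r tliftB // t0 add0r opprK.
Qed.

Lemma balanced_tens : balanced tens.
Proof.
split=> [n m m'|m n n'|m s n]; rewrite !tens_pi -?raddfD; 
  apply/pi_eqP; rewrite ?opprD ?addrA.
- exact: tnull_addl.
- exact: tnull_addr.
- exact: tnull_bal.
Qed.

Lemma tens_span (Q : tensor_zmod -> Prop) :
  Q 0 -> (forall u v, Q u -> Q v -> Q (u - v)) ->
  (forall m n, Q (tens m n)) -> forall u, Q u.
Proof.
move=> Q0 QB Qt u; have QN v : Q v -> Q (- v) by rewrite -sub0r; apply: QB.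
have QD v w : Q v -> Q w -> Q (v + w).
  by move=> Qv /QN Qw; rewrite -[w]opprK; apply: QB.
have QM v n : Q v -> Q (v *+ n).
  by move=> Qv; elim: n => [|n IHn]; rewrite ?mulr0n // mulrS; apply: QD.
rewrite -[u]reprK [repr _]monalgE raddf_sum /=; elim/big_ind: _ => // p _.
have -> : << (repr u)@_p *g p >> = << p >> *~ (repr u)@_p :> free.
  by apply/malgP => q; rewrite raddfMz /= !mcoeffU; case: eqP; rewrite ?mul0rz ?intz.
by rewrite raddfMz; case: p => m n; case: (_@_ _) => i;
  rewrite ?NegzE ?mulrNz -?pmulrn; do ?apply: QN; apply: QM; have := Qt m n; rewrite tens_pi.
Qed.

Lemma tlift_ext (P : zmodType) (f g : tensor_zmod -> P) :
  {morph f : u v / u - v} -> {morph g : u v / u - v} ->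
  (forall m n, f (tens m n) = g (tens m n)) -> f =1 g.
Proof.
move=> fB gB fg; apply: tens_span => [|u v fu fv|//].
  by rewrite -(subrr 0) fB gB !subrr.
by rewrite fB gB fu fv.
Qed.

End Tensor.

Notation "m ⊗ n" := (tens m n) : ring_scope.

Section TensorMap.
Variables (R S U R' U' : pzRingType).
Variables (M : bimodule R S) (N : bimodule S U).
Variables (M' : bimodule R' S) (N' : bimodule S U').

(* f ⊗ g, for f right S-linear and g left S-linear. *)
Definition tmap (f : M -> M') (g : N -> N') : tensor_zmod M N -> tensor_zmod M' N' :=
  tlift (fun m n => f m ⊗ g n).

Lemma balanced_tmap (f : M -> M') (g : N -> N') :
  {morph f : m m' / m + m'} -> (forall (m : M) s, f (m *:r s) = f m *:r s) ->
  {morph g : n n' / n + n'} -> (forall s (n : N), g (s *:l n) = s *:l g n) ->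
  balanced (fun m n => f m ⊗ g n).
Proof.
have [tDl tDr tb] := balanced_tens M' N'.
by move=> fD fZ gD gZ; split=> [n m m'|m n n'|m s n];
  rewrite (fD, gD, fZ) ?gZ (tDl, tDr, tb).
Qed.
End TensorMap.

Section TensorBimodule.
Variables (R S U : pzRingType) (M : bimodule R S) (N : bimodule S U).

Definition tensor_lact (r : R) : tensor_zmod M N -> tensor_zmod M N :=
  tmap (lact r) id.
Definition tensor_ract (u : tensor_zmod M N) (s : U) : tensor_zmod M N :=
  tmap id (fun n => n *:r s) u.

Lemma balanced_lact r : balanced (fun (m : M) (n : N) => (r *:l m) ⊗ n).
Proof.
by apply: (balanced_tmap (f := lact r) (g := id)) => // [|m s];
  [exact: lactDr|rewrite lractA].
Qed.

Lemma balanced_ract s : balanced (fun (m : M) (n : N) => m ⊗ (n *:r s)).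
Proof.
by apply: (balanced_tmap (f := id) (g := fun n : N => n *:r s)) => // [|r n];
  [exact: ractDl|rewrite lractA].
Qed.

Lemma tensor_lactE r m n : tensor_lact r (m ⊗ n) = (r *:l m) ⊗ n.
Proof. exact: tlift_tens (balanced_lact r). Qed.
Lemma tensor_ractE m n s : tensor_ract (m ⊗ n) s = m ⊗ (n *:r s).
Proof. exact: tlift_tens (balanced_ract s). Qed.
Lemma tensor_lactB r : {morph tensor_lact r : u v / u - v}.
Proof. exact: tliftB (balanced_lact r). Qed.
Lemma tensor_ractB s : {morph tensor_ract^~ s : u v / u - v}.
Proof. exact: tliftB (balanced_ract s). Qed.
Lemma tensor_lactDr r : {morph tensor_lact r : u v / u + v}.
Proof. exact: tliftD (balanced_lact r). Qed.
Lemma tensor_ractDl s : {morph tensor_ract^~ s : u v / u + v}.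
Proof. exact: tliftD (balanced_ract s). Qed.

Let subrACA (V : zmodType) (a b c d : V) : a - b + (c - d) = a + c - (b + d).
Proof. by rewrite addrACA opprD. Qed.

Program Definition tensor : bimodule R U :=
  @Bimodule R U (tensor_zmod M N) tensor_lact tensor_ract
    tensor_lactDr _ _ _ tensor_ractDl _ _ _ _.
Next Obligation.
move=> u r s; move: u; apply: tlift_ext => [u v|u v|m n].
- exact: tensor_lactB.
- by rewrite !tensor_lactB subrACA.
- by rewrite !tensor_lactE lactDl; have [-> _ _] := balanced_tens M N.
Qed.
Next Obligation.
apply: tlift_ext => // [u v|m n]; first exact: tensor_lactB.
by rewrite tensor_lactE lact1.
Qed.
Next Obligation.
move=> r s; apply: tlift_ext => [u v|u v|m n]; rewrite ?tensor_lactB //.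
by rewrite !tensor_lactE lactA.
Qed.
Next Obligation.
move=> u r s; move: u; apply: tlift_ext => [u v|u v|m n].
- exact: tensor_ractB.
- by rewrite !tensor_ractB subrACA.
- by rewrite !tensor_ractE ractDr; have [_ -> _] := balanced_tens M N.
Qed.
Next Obligation.
apply: tlift_ext => // [u v|m n]; first exact: tensor_ractB.
by rewrite tensor_ractE ract1.
Qed.
Next Obligation.
move=> u r s; move: u; apply: tlift_ext => [u v|u v|m n]; rewrite ?tensor_ractB //.
by rewrite !tensor_ractE ractA.
Qed.
Next Obligation.
move=> r u s; move: u; apply: tlift_ext => [u v|u v|m n].
- by rewrite tensor_lactB tensor_ractB.
- by rewrite tensor_ractB tensor_lactB.
- by rewrite tensor_lactE !tensor_ractE tensor_lactE.
Qed.
End TensorBimodule.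

Section Associator.
Variables (R S U V : pzRingType).
Variables (M : bimodule R S) (N : bimodule S U) (P : bimodule U V).

Definition tassoc : tensor (tensor M N) P -> tensor M (tensor N P) :=
  tlift (fun (u : tensor M N) p =>
    tlift (fun m n => (m ⊗ ((n ⊗ p) : tensor N P) : tensor M (tensor N P))) u).

Lemma tassocE m n p :
  tassoc (((m ⊗ n) : tensor M N) ⊗ p) = m ⊗ ((n ⊗ p) : tensor N P).
Proof.
have [lD rD b] := balanced_tens M (tensor N P).
have [lD' rD' b'] := balanced_tens N P.
have bal p' : balanced
    (fun m n => (m ⊗ ((n ⊗ p') : tensor N P) : tensor M (tensor N P))).
  split=> [n0 m0 m1|m0 n0 n1|m0 s n0]; first exact: lD.
  - by rewrite /= lD'; apply: rD.
  - by rewrite /= b /= tensor_lactE.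
rewrite /tassoc tlift_tens; first by rewrite tlift_tens.
split=> [p'|u p1 p2|u s p']; first exact: (tliftD (bal p')).
- move: u; apply: tlift_ext => [u v|u v|m0 n0].
  + by rewrite (tliftB (bal (p1 + p2))).
  + by rewrite (tliftB (bal p1)) (tliftB (bal p2)) opprD addrACA.
  + rewrite (tlift_tens _ _ (bal _)) (tlift_tens _ _ (bal p1))
      (tlift_tens _ _ (bal p2)) rD'; exact: rD.
- move: u; apply: tlift_ext => [u v|u v|m0 n0].
  + by rewrite /= tensor_ractB (tliftB (bal p')).
  + by rewrite (tliftB (bal (s *:l p'))).
  + by rewrite /= tensor_ractE (tlift_tens _ _ (bal p'))
      (tlift_tens _ _ (bal (s *:l p'))) b'.
Qed.
End Associator.

Section Extension.
Variables (k : comPzRingType) (A B : kalgebra k) (iota : {rmorphism B -> A}).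

Definition ext_bimod : bimodule A B := ring_bimod (@idfun A) iota.

(* A ⊗_B A with its natural A-B-bimodule structure. *)
Definition ext_tensor : bimodule A B :=
  tensor ext_bimod (ring_bimod iota iota).

Definition right_depth_two : Prop :=
  exists I : choiceType, iso_direct_summand ext_tensor (bimod_copow I ext_bimod).

Definition in_End_AB (f : A -> A) : Prop :=
  {morph f : x y / x + y} /\ forall x b, f (x * iota b) = f x * iota b.

Definition in_End_EA (g : A -> A) : Prop :=
  {morph g : x y / x + y} /\ forall f, in_End_AB f -> forall x, g (f x) = f (g x).

Definition right_balanced : Prop :=
  forall g, in_End_EA g -> exists b, forall x, g x = x * iota b.

End Extension.

Record coring (R : pzRingType) (C : bimodule R R) := Coring {
  comul : C -> tensor C C;
  counit : C -> R;
  comul_hom : bimod_hom comul;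
  counit_hom : @bimod_hom R R C (regular_bimod R) counit;
  comulA : forall c, tassoc (tmap comul id (comul c)) = tmap id comul (comul c);
  counitl : forall c, tlift (fun x y => counit x *:l y) (comul c) = c;
  counitr : forall c, tlift (fun x y => x *:r counit y) (comul c) = c
}.

Record source_target_ring (k : comPzRingType) (R : kalgebra k) := SourceTargetRing {
  st_alg :> kalgebra k;
  src : {rmorphism R -> st_alg};
  tgt : R -> st_alg;
  src_over_base : over_base src;
  tgt_over_base : over_base tgt;
  tgtD : {morph tgt : r s / r + s};
  tgt1 : tgt 1 = 1;
  tgtM : forall r s, tgt (r * s) = tgt s * tgt r;
  src_tgtC : forall r s, src r * tgt s = tgt s * src r
}.

(* T as an R-R-bimodule: r . x . s = x * tgt r * src s. *)
Program Definition st_bimod (k : comPzRingType) (R : kalgebra k)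
    (T : source_target_ring R) : bimodule R R :=
  @Bimodule R R T (fun r x => x * tgt T r) (fun x s => x * src T s)
    _ _ _ _ _ _ _ _ _.
Next Obligation. by move=> k R T r x y /=; rewrite mulrDl. Qed.
Next Obligation. by move=> k R T x r s /=; rewrite tgtD mulrDr. Qed.
Next Obligation. by move=> k R T x /=; rewrite tgt1 mulr1. Qed.
Next Obligation. by move=> k R T r s x /=; rewrite tgtM mulrA. Qed.
Next Obligation. by move=> k R T s x y /=; rewrite mulrDl. Qed.
Next Obligation. by move=> k R T x r s /=; rewrite rmorphD mulrDr. Qed.
Next Obligation. by move=> k R T x /=; rewrite rmorph1 mulr1. Qed.
Next Obligation. by move=> k R T x r s /=; rewrite rmorphM mulrA. Qed.
Next Obligation. by move=> k R T r x s /=; rewrite -!mulrA src_tgtC. Qed.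

Definition st_mul (k : comPzRingType) (R : kalgebra k)
    (T : source_target_ring R) : st_bimod T -> st_bimod T -> st_bimod T :=
  fun x y : T => x * y.

(* u_1 v_1 ⊗ u_2 v_2 for given products on M and N.  This does not    *)
(* factor through the tensor product for arbitrary v, but it does when  *)
(* v satisfies the exchange conditions below.                           *)
Definition tmul (R S U : pzRingType) (M : bimodule R S) (N : bimodule S U)
    (mulM : M -> M -> M) (mulN : N -> N -> N) (u v : tensor M N) : tensor M N :=
  tlift (fun m n => tmap (mulM m) (mulN n) v) u.

Record right_bialgebroid (k : comPzRingType) (R : kalgebra k) := RightBialgebroid {
  bi_ring :> source_target_ring R;
  bi_coring : coring (st_bimod bi_ring);
  comul1 : comul bi_coring 1 = @tens _ _ _ (st_bimod bi_ring) (st_bimod bi_ring) 1 1;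
  counit1 : counit bi_coring 1 = 1;
  comul_exchange : forall (r : R) (t : bi_ring),
    tmap (st_mul (src bi_ring r)) id (comul bi_coring t) =
    tmap id (st_mul (tgt bi_ring r)) (comul bi_coring t);
  comulM : forall t u : bi_ring,
    comul bi_coring (t * u) =
    tmul (@st_mul _ _ _) (@st_mul _ _ _) (comul bi_coring t) (comul bi_coring u);
  counitM_src : forall t u : bi_ring,
    counit bi_coring (t * u) =
    counit bi_coring (src bi_ring (counit bi_coring t) * u);
  counitM_tgt : forall t u : bi_ring,
    counit bi_coring (t * u) =
    counit bi_coring (tgt bi_ring (counit bi_coring t) * u)
}.

Section Galois.
Variables (k : comPzRingType) (R : kalgebra k) (T : right_bialgebroid R).
Variables (A : kalgebra k) (j : {rmorphism R -> A}).

(* A ⊗_R T, with the left action of A kept. *)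
Definition coact_bimod : bimodule A R := ext_bimod j.
Definition coact_mul : coact_bimod -> coact_bimod -> coact_bimod :=
  fun x y : A => x * y.
Definition coact_tensor : bimodule A R := tensor coact_bimod (st_bimod T).

Record comodule_algebra (delta : coact_bimod -> coact_tensor) : Prop :=
  ComoduleAlgebra {
    base_over_base : over_base j;
    coactD : {morph delta : x y / x + y};
    coactZ : forall (a : A) (r : R), delta (a * j r) = delta a *:r r;
    coact_counit : forall a : A,
      tlift (fun (x : coact_bimod) (t : st_bimod T) =>
               (x : A) * j (counit (bi_coring T) t)) (delta a) = a;
    coactA : forall a : A,
      tassoc (tmap delta id (delta a) : tensor coact_tensor (st_bimod T)) =
      tmap id (comul (bi_coring T)) (delta a);
    coact1 : delta 1 = @tens _ _ _ coact_bimod (st_bimod T) 1 1;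
    coact_exchange : forall (r : R) (a : A),
      j r *:l delta a = tmap id (st_mul (tgt T r)) (delta a);
    coactM : forall x y : A,
      delta (x * y) =
      tmul coact_mul (@st_mul _ _ _) (delta x) (delta y)
  }.

Variables (B : kalgebra k) (iota : {rmorphism B -> A}).

Definition coinvariants_are_base (delta : coact_bimod -> coact_tensor) : Prop :=
  forall x : A,
    delta x = @tens _ _ _ coact_bimod (st_bimod T) x 1 <-> exists b, x = iota b.

Definition canonical_map (delta : coact_bimod -> coact_tensor) :
    ext_tensor iota -> coact_tensor :=
  tlift (fun (x : ext_bimod iota) (y : ring_bimod iota iota) =>
           (x : A) *:l delta y).

End Galois.

Definition right_galois (k : comPzRingType) (A B : kalgebra k)
    (iota : {rmorphism B -> A}) (R : kalgebra k) (T : right_bialgebroid R) : Prop :=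
  exists (j : {rmorphism R -> A}) (delta : coact_bimod j -> coact_tensor T j),
    [/\ comodule_algebra delta, coinvariants_are_base iota delta
      & bijective (canonical_map delta : ext_tensor iota -> _)].

(* Main.v *)
From HB Require Import structures.
From mathcomp Require Import all_boot all_order all_algebra.
From mathcomp Require Import finmap boolp.
From mathcomp Require Import monalg.
Require Import Defs.

Set Implicit Arguments.
Unset Strict Implicit.
Unset Printing Implicit Defensive.

Import GRing.Theory.
Local Open Scope ring_scope.

#[local] Obligation Tactic := idtac.

(** An A-B-bimodule map A -> A ⊗_B A is a |-> a t with t in
    T = (A ⊗_B A)^B, and an A-B-bimodule map A ⊗_B A -> A is
    x ⊗ y |-> x γ(y) with γ in End(_B A_B).  Right depth two therefore means
    that there is a quasibase: elements t_i of T and endomorphisms γ_i such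
    that x ⊗ y = Σ x γ_i(y) t_i, a finite sum for each y
    (depth_two_quasibase, quasibase_depth_two).

    Depth two and balanced imply Galois.  Take for R the centralizer of B in A,
    and for T the ring above with product t u = u^1 t u^2, where
    v = v^1 ⊗ v^2 in Sweedler style.  Restricted to T, a quasibase is a dual
    basis of T as a left R-module, so T is projective and an element of
    M ⊗_R T is determined by its coordinates.  The comultiplication and the
    coaction are the maps for which Δ(t) becomes t^1 ⊗ 1 ⊗ t^2 in
    A ⊗_B A ⊗_B A and δ(a) becomes 1 ⊗ a in A ⊗_B A.  Triple tensor products
    are avoided by testing an element of M ⊗_R T against all left B-linear
    endomorphisms f of A, through m ⊗ t |-> m (t^1 f(t^2)).  These maps
    separate points (ev_inj), and Δ and δ are characterized by the values
    t^1 ⊗ f(t^2) and f(a) (ev_comul, ev_coact).  All bialgebroid and comodule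
    axioms but coassociativity thus become identities in A or A ⊗_B A that can
    be read off on pure tensors; coassociativity follows from the expansion
    Δ(t) = Σ (t^1 ⊗ γ_i(t^2)) ⊗ t_i (comul_tmap_expand).  The canonical map is
    inverse to a ⊗ t |-> a t (ct_can_bij).  Finally δ(x) = x ⊗ 1 says that
    1 ⊗ x = x ⊗ 1 in A ⊗_B A, so that right multiplication by x commutes with
    End(A_B), and x lies in B because the extension is balanced
    (ct_coinvariants).

    Galois with T projective implies depth two and balanced.  Let t_i, f_i be a
    dual basis of T.  Through the canonical isomorphism β, the maps
    γ_i(y) = y_(0) f_i(y_(1)) and the elements β^-1(1 ⊗ t_i) form a quasibase
    (galois_depth_two).  An endomorphism of A commuting with End(A_B) commutes
    with left multiplications, hence is right multiplication by some c.  It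
    also commutes with right multiplication by R and with each γ_i, whence
    c_(0) f_i(c_(1)) = f_i(1) c = c f_i(1) for all i.  So δ(c) = c ⊗ 1 and c lies
    in B (galois_balanced). *)

(** * Tensor products and direct summands *)

Section AdditiveMaps.
Variables (U V : zmodType) (f : U -> V).

Lemma morphD_B : {morph f : x y / x + y} -> {morph f : x y / x - y}.
Proof.
by move=> fD x y; apply: (addIr (f y)); rewrite -fD !subrK.
Qed.

Hypothesis fB : {morph f : x y / x - y}.

Lemma morphB_0 : f 0 = 0.
Proof. by rewrite -(subrr 0) fB subrr. Qed.

Lemma morphB_N : {morph f : x / - x}.
Proof. by move=> x; rewrite -sub0r fB morphB_0 sub0r. Qed.

Lemma morphB_D : {morph f : x y / x + y}.
Proof. by move=> x y; rewrite -[y in LHS]opprK fB morphB_N opprK. Qed.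

Lemma morphB_sum (I : Type) (s : seq I) (g : I -> U) :
  f (\sum_(i <- s) g i) = \sum_(i <- s) f (g i).
Proof. exact: (big_morph f morphB_D morphB_0). Qed.
End AdditiveMaps.

Section BimoduleActions.
Variables (R S : pzRingType) (M : bimodule R S).

Lemma lactB r : {morph lact r : m n / m - n :> M}.
Proof. exact: morphD_B (lactDr r). Qed.

Lemma lactBl (m : M) : {morph (@lact _ _ M)^~ m : r s / r - s}.
Proof. exact: morphD_B (lactDl m). Qed.

Lemma ractB s : {morph (@ract _ _ M)^~ s : m n / m - n}.
Proof. exact: morphD_B (ractDl s). Qed.

Lemma ractBr (m : M) : {morph ract m : r s / r - s}.
Proof. exact: morphD_B (ractDr m). Qed.
End BimoduleActions.

Section TensorRules.
Variables (R S U : pzRingType) (M : bimodule R S) (N : bimodule S U).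
Implicit Types (m : M) (n : N).

Lemma tensDl n : {morph @tens _ _ _ M N ^~ n : m m' / m + m'}.
Proof. by have [H _ _] := balanced_tens M N; apply: H. Qed.

Lemma tensDr m : {morph @tens _ _ _ M N m : n n' / n + n'}.
Proof. by have [_ H _] := balanced_tens M N; apply: H. Qed.

Lemma tens_bal m s n : (m *:r s) ⊗ n = m ⊗ (s *:l n).
Proof. by have [_ _ ->] := balanced_tens M N. Qed.

Lemma tens_lact r m n : r *:l (m ⊗ n : tensor M N) = (r *:l m) ⊗ n.
Proof. exact: tensor_lactE. Qed.

Lemma tens_ract m n s : (m ⊗ n : tensor M N) *:r s = m ⊗ (n *:r s).
Proof. exact: tensor_ractE. Qed.

Lemma tensBl n : {morph @tens _ _ _ M N ^~ n : m m' / m - m'}.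
Proof. exact: morphD_B (tensDl n). Qed.

Lemma tensBr m : {morph @tens _ _ _ M N m : n n' / n - n'}.
Proof. exact: morphD_B (tensDr m). Qed.

Lemma tens_sumr (I : Type) (s : seq I) (g : I -> N) m :
  m ⊗ (\sum_(i <- s) g i) = \sum_(i <- s) m ⊗ g i :> tensor_zmod M N.
Proof. exact: (morphB_sum (tensBr m)). Qed.

Lemma tens0l n : (0 : M) ⊗ n = 0 :> tensor_zmod M N.
Proof. exact: (morphB_0 (tensBl n)). Qed.
End TensorRules.

Section DirectSummand.
Variables (R S : pzRingType).

Record bimod_morphism (M N : bimodule R S) :=
  BimodMorphism { bmor :> M -> N; bmorP : bimod_hom bmor }.

Variables (M N : bimodule R S) (G : bimod_morphism N M).

Lemma bmorB : {morph G : x y / x - y}.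
Proof. by have [GD _ _] := bmorP G; apply: morphD_B. Qed.

Definition in_kernel : pred N := fun n => G n == 0.

Lemma in_kernel_closed : zmod_closed in_kernel.
Proof.
split=> [|x y]; rewrite /in_kernel unfold_in /= ?(morphB_0 bmorB) //.
by move=> /eqP x0 /eqP y0; rewrite unfold_in bmorB x0 y0 subrr.
Qed.

HB.instance Definition _ := GRing.isZmodClosed.Build N in_kernel in_kernel_closed.

Record kernel := Kernel { kernel_val : N; _ : in_kernel kernel_val }.
HB.instance Definition _ := [isSub for kernel_val].
HB.instance Definition _ := [Choice of kernel by <:].
HB.instance Definition _ := [SubChoice_isSubZmodule of kernel by <:].

Lemma kernelP (x : kernel) : G (kernel_val x) = 0.
Proof. by apply/eqP; case: x. Qed.

Lemma kernel_valD : {morph kernel_val : x y / x + y}.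
Proof. exact: (raddfD (val : {additive kernel -> N})). Qed.

Lemma kernel_eqD (x y z : kernel) :
  kernel_val x = kernel_val y + kernel_val z -> x = y + z.
Proof. by rewrite -kernel_valD => /val_inj. Qed.

Lemma kernel_lact_subproof r (x : kernel) : in_kernel (r *:l kernel_val x).
Proof. by have [_ GZ _] := bmorP G; rewrite /in_kernel GZ kernelP lact0. Qed.
Lemma kernel_ract_subproof (x : kernel) s : in_kernel (kernel_val x *:r s).
Proof. by have [_ _ GZ] := bmorP G; rewrite /in_kernel GZ kernelP ract0. Qed.

Program Definition kernel_bimod : bimodule R S :=
  @Bimodule R S (GRing.Zmodule.clone kernel _) (fun r x => Kernel (kernel_lact_subproof r x))
    (fun x s => Kernel (kernel_ract_subproof x s)) _ _ _ _ _ _ _ _ _.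
Next Obligation. by move=> r x y; apply: kernel_eqD; rewrite /= lactDr. Qed.
Next Obligation. by move=> x r s; apply: kernel_eqD; rewrite /= lactDl. Qed.
Next Obligation. by move=> x; apply: val_inj; rewrite /= lact1. Qed.
Next Obligation. by move=> r s x; apply: val_inj; rewrite /= lactA. Qed.
Next Obligation. by move=> s x y; apply: kernel_eqD; rewrite /= ractDl. Qed.
Next Obligation. by move=> x r s; apply: kernel_eqD; rewrite /= ractDr. Qed.
Next Obligation. by move=> x; apply: val_inj; rewrite /= ract1. Qed.
Next Obligation. by move=> x r s; apply: val_inj; rewrite /= ractA. Qed.
Next Obligation. by move=> r x s; apply: val_inj; rewrite /= lractA. Qed.

(** The complement of the image of F is the kernel of its retraction G. *)
Lemma retract_summand (F : bimod_morphism M N) :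
  cancel F G -> iso_direct_summand M N.
Proof.
move=> FK; have [FD FZl FZr] := bmorP F; have [GD GZl GZr] := bmorP G.
have proj n : in_kernel (n - F (G n)) by rewrite /in_kernel bmorB FK subrr.
exists kernel_bimod, (fun x => F x.1 + kernel_val x.2); split.
  split=> [[m x] [m' x']|r [m x]|[m x] s] /=.
  - by rewrite FD addrACA.
  - by rewrite FZl lactDr.
  - by rewrite FZr ractDl.
exists (fun n => (G n, Kernel (proj n))) => [[m x]|n] /=; last by rewrite addrC subrK.
have GE : G (F m + kernel_val x) = m by rewrite GD FK kernelP addr0.
by congr pair => //; apply: val_inj; rewrite /= GE addrAC subrr add0r.
Qed.
End DirectSummand.

Lemma summand_retract (R S : pzRingType) (M N : bimodule R S) :
  iso_direct_summand M N ->
  exists (F : bimod_morphism M N) (G : bimod_morphism N M), cancel F G.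
Proof.
case=> C [phi [[phiD phiZl phiZr] [psi phiK psiK]]].
have phiI := can_inj phiK.
have F_hom : bimod_hom (fun m : M => phi (m, 0 : C)).
  split=> [m m'|r m|m s].
  - by rewrite -phiD; congr phi; congr pair; rewrite /= addr0.
  - by rewrite -phiZl; congr phi; congr pair; rewrite /= lact0.
  - by rewrite -phiZr; congr phi; congr pair; rewrite /= ract0.
have G_hom : bimod_hom (fun n => (psi n).1 : M).
  split=> [n n'|r n|n s].
  - by rewrite -[n]psiK -[n']psiK -phiD !phiK.
  - by rewrite -[n]psiK -phiZl !phiK.
  - by rewrite -[n]psiK -phiZr !phiK.
by exists (BimodMorphism F_hom), (BimodMorphism G_hom) => m /=; rewrite phiK.
Qed.

(** * Linear combinations and dual bases *)

Section LinearCombination.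
Variables (R S : pzRingType) (M : bimodule R S) (I : choiceType) (e : I -> M).
Implicit Types g : {malg R[I]}.

Definition lcomb g : M := \sum_(i <- msupp g) g@_i *:l e i.

Lemma lact0l (m : M) : (0 : R) *:l m = 0.
Proof. exact: (morphB_0 (lactBl m)). Qed.

Lemma lcombE g (D : {fset I}) :
  (msupp g `<=` D)%fset -> lcomb g = \sum_(i <- D) g@_i *:l e i.
Proof.
move=> sgD; rewrite /lcomb (big_fset_incl _ sgD) //= => i _ /mcoeff_outdom ->.
exact: lact0l.
Qed.

Lemma lcombB : {morph lcomb : g h / g - h}.
Proof.
move=> g h; pose D := (msupp g `|` msupp h)%fset.
rewrite (@lcombE (g - h) D) ?msuppB_le // (@lcombE g D) ?fsubsetUl //.
rewrite (@lcombE h D) ?fsubsetUr // -sumrB.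
by apply: eq_bigr => i _; rewrite mcoeffB lactBl.
Qed.

Lemma lcombU i r : lcomb << r *g i >> = r *:l e i.
Proof. by rewrite (lcombE msuppU_le) big_seq_fset1 mcoeffUU. Qed.

Lemma lcomb_lact r g (h : {malg R[I]}) :
  (forall i, h@_i = r * g@_i) -> lcomb h = r *:l lcomb g.
Proof.
move=> hE; have shg : (msupp h `<=` msupp g)%fset.
  apply/fsubsetP=> i; rewrite -!mcoeff_neq0 hE; apply: contraNneq => ->.
  by rewrite mulr0.
rewrite (lcombE shg) (morphB_sum (lactB r)).
by apply: eq_bigr => i _; rewrite hE lactA.
Qed.
End LinearCombination.

(** Projectivity is tested on left modules over R, while combinations are
    formed in bimodules: a left module is a bimodule over R and the integers,
    and a bimodule has an underlying left module. *)
Section LmodBimod.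
Variables (R : pzRingType) (X : lmodType R).

Program Definition lmod_bimod : bimodule R int :=
  @Bimodule R int X (fun r x => r *: x) (fun x n => x *~ n) _ _ _ _ _ _ _ _ _.
Next Obligation. by move=> r x y /=; rewrite scalerDr. Qed.
Next Obligation. by move=> x r s /=; rewrite scalerDl. Qed.
Next Obligation. by move=> x /=; rewrite scale1r. Qed.
Next Obligation. by move=> r s x /=; rewrite scalerA. Qed.
Next Obligation. by move=> n x y /=; rewrite mulrzDl. Qed.
Next Obligation. by move=> x m n /=; rewrite mulrzDr. Qed.
Next Obligation. by []. Qed.
Next Obligation. by move=> x m n /=; rewrite mulrzA. Qed.
Next Obligation. by move=> r x n /=; rewrite scalerMzr. Qed.
End LmodBimod.

Section BimodLmod.
Variables (R S : pzRingType) (M : bimodule R S).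

Definition left_module : Type := M.
HB.instance Definition _ := GRing.Zmodule.on left_module.

Lemma left_moduleA r s (m : left_module) : r *:l (s *:l (m : M)) = (r * s) *:l (m : M).
Proof. by rewrite lactA. Qed.

HB.instance Definition _ := GRing.Zmodule_isLmodule.Build R left_module
  left_moduleA (@lact1 R S M) (@lactDr R S M) (@lactDl R S M).
End BimodLmod.

Section DualBasis.
Variables (R S : pzRingType) (M : bimodule R S).

(** The coordinates of m form one finitely supported family f m, so that the
    local finiteness of a dual basis is carried by the type. *)
Definition dual_basis (I : choiceType) (e : I -> M) (f : M -> {malg R[I]}) : Prop :=
  [/\ {morph f : m n / m + n}, forall r m i, (f (r *:l m))@_i = r * (f m)@_i
    & forall m, lcomb e (f m) = m].

Lemma dual_basis_projective (I : choiceType) (e : I -> M) (f : M -> {malg R[I]}) :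
  dual_basis e f -> left_projective M.
Proof.
case=> fD fZ fK X Y p h p_surj [hD hZ].
have [x xE] := choice (fun i => p_surj (h (e i))).
exists (fun m => lcomb (x : I -> lmod_bimod X) (f m)); split; first split.
- by move=> m n; rewrite fD (morphB_D (lcombB _)).
- by move=> r m; apply: (@lcomb_lact _ _ (lmod_bimod X)) => i; rewrite fZ.
move=> m; rewrite -{2}[m]fK /lcomb raddf_sum (morphB_sum (morphD_B hD)).
by apply: eq_bigr => i _; rewrite hZ -xE; exact: linearZ.
Qed.

(** The free module on the set M maps onto M; a section of this map provides
    coordinates with respect to the family of all elements of M. *)
Lemma projective_dual_basis : left_projective M ->
  exists (I : choiceType) (e : I -> M) (f : M -> {malg R[I]}), dual_basis e f.
Proof.
pose F := bimod_copow M (regular_bimod R).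
pose p : left_module F -> left_module M := lcomb (@id M).
have p_lin : linear p.
  move=> r g h; rewrite /p (morphB_D (lcombB _)); congr (_ + _).
  apply: (@lcomb_lact _ _ M) => i; exact: (copow_lactE (M := regular_bimod R)).
pose pL : {linear left_module F -> left_module M} :=
  HB.pack p (GRing.isLinear.Build R _ _ _ p p_lin).
move=> /(_ (left_module F) (left_module M) pL (fun m => m)).
case=> [m||f [[fD fZ] fK]]; [|by []|].
  by exists << 1 *g (m : M) >>; rewrite /= /p lcombU lact1.
exists M, id, f; split=> // r m i; rewrite fZ.
exact: (copow_lactE (M := regular_bimod R)).
Qed.
End DualBasis.

Section Eventually.
Variable I : choiceType.

(** An identity between sums over I that are finite, but over supports that
    depend on the argument, holds for every large enough finite set of
    indices; in this form it is stable under differences of arguments, hence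
    provable on pure tensors. *)
Definition eventually (P : {fset I} -> Prop) : Prop :=
  exists S0 : {fset I}, forall S, (S0 `<=` S)%fset -> P S.

Lemma eventually_and P Q :
  eventually P -> eventually Q -> eventually (fun S => P S /\ Q S).
Proof.
case=> [S1 PS] [S2 QS]; exists (S1 `|` S2)%fset => S.
by rewrite fsubUset => /andP[/PS ? /QS ?].
Qed.

Lemma eventually_sub (P Q : {fset I} -> Prop) :
  (forall S, P S -> Q S) -> eventually P -> eventually Q.
Proof. by move=> PQ [S0 PS]; exists S0 => S /PS/PQ. Qed.

Lemma eventually_true (P : {fset I} -> Prop) : (forall S, P S) -> eventually P.
Proof. by exists fset0. Qed.

Lemma eventually_ex P : eventually P -> exists S, P S.
Proof. by case=> S PS; exists S; apply: PS. Qed.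
End Eventually.

Section TensorCoordinates.
Variables (Q R S : pzRingType) (M : bimodule Q R) (N : bimodule R S).
Variables (I : choiceType) (e : I -> N) (f : N -> {malg R[I]}).
Hypothesis ef : dual_basis e f.

Definition tcoord i : tensor_zmod M N -> M := tlift (fun m n => m *:r (f n)@_i).

Lemma balanced_tcoord i : balanced (fun (m : M) (n : N) => m *:r (f n)@_i).
Proof.
have [fD fZ _] := ef; split=> [n m m'|m n n'|m r n].
- exact: ractDl.
- by rewrite fD mcoeffD ractDr.
- by rewrite fZ ractA.
Qed.

Lemma tcoordE i m n : tcoord i (m ⊗ n) = m *:r (f n)@_i.
Proof. exact: tlift_tens (balanced_tcoord i). Qed.
Lemma tcoordB i : {morph tcoord i : u v / u - v}.
Proof. exact: tliftB (balanced_tcoord i). Qed.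

Lemma tcoord_expand u :
  eventually (fun D : {fset I} => u = \sum_(i <- D) tcoord i u ⊗ e i).
Proof.
move: u; apply: tens_span => [|u v Pu Pv|m n].
- apply: eventually_true => D; rewrite big1 // => i _.
  by rewrite (morphB_0 (tcoordB i)) tens0l.
- apply: eventually_sub (eventually_and Pu Pv) => D [uE vE].
  rewrite [in LHS]uE [in LHS]vE -sumrB.
  by apply: eq_bigr => i _; rewrite tcoordB tensBl.
- have [_ _ fK] := ef; exists (msupp (f n)) => D sD.
  rewrite -[n in LHS]fK (lcombE _ sD) tens_sumr.
  by apply: eq_bigr => i _; rewrite tcoordE tens_bal.
Qed.

(** The use of projectivity: a tensor vanishes as soon as its coordinates do,
    although M is arbitrary. *)
Lemma tcoord_inj u v : (forall i, tcoord i u = tcoord i v) -> u = v.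
Proof.
move=> uv; have [D [-> ->]] :=
  eventually_ex (eventually_and (tcoord_expand u) (tcoord_expand v)).
by apply: eq_bigr => i _; rewrite uv.
Qed.

(** All coordinates at once; the support is finite because it is so for pure
    tensors. *)
Definition tcoords : tensor_zmod M N -> {malg M[I]} :=
  tlift (fun (m : M) (n : N) => [malg i in msupp (f n) => m *:r (f n)@_i]).

Lemma tcoordsE u i : (tcoords u)@_i = tcoord i u.
Proof.
have mE m n j : [malg i in msupp (f n) => m *:r (f n)@_i]@_j = m *:r (f n)@_j.
  rewrite mcoeffE; case: msuppP => // _.
  by rewrite (morphB_0 (ractBr m)).
have bal : balanced (fun (m : M) (n : N) => [malg i in msupp (f n) => m *:r (f n)@_i]).
  split=> [n m m'|m n n'|m r n]; apply/malgP => j; rewrite ?mcoeffD !mE;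
    have [tD1 tD2 tb] := balanced_tcoord j.
  - exact: tD1.
  - exact: tD2.
  - exact: tb.
move: u; apply: tlift_ext => [u v|u v|m n].
- by rewrite /tcoords (tliftB bal) mcoeffB.
- exact: tcoordB.
- by rewrite [X in X@__](tlift_tens _ _ bal) mE tcoordE.
Qed.

Lemma tcoords_expand u : u = \sum_(i <- msupp (tcoords u)) tcoord i u ⊗ e i.
Proof.
have [S0 uE] := tcoord_expand u.
rewrite {1}(uE (S0 `|` msupp (tcoords u))%fset) ?fsubsetUl //.
apply/esym/big_fset_incl => [|i _ /mcoeff_outdom]; first exact: fsubsetUr.
by rewrite tcoordsE => ->; rewrite tens0l.
Qed.
End TensorCoordinates.

(* Otherwise simplification replaces the action on a concrete bimodule by its
   formula, to which the bimodule laws no longer apply. *)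
#[local] Arguments lact : simpl never.
#[local] Arguments ract : simpl never.
#[local] Arguments bimod_sort : simpl never.

Section RingBimodActions.
Variables (A R S : pzRingType) (f : {rmorphism R -> A}) (g : {rmorphism S -> A}).

Lemma ring_lactE r (a : ring_bimod f g) : r *:l a = f r * (a : A).
Proof. by []. Qed.

Lemma ring_ractE (a : ring_bimod f g) s : a *:r s = (a : A) * g s.
Proof. by []. Qed.
End RingBimodActions.

(** * The bimodule A ⊗_B A *)

Section ExtensionTensor.
Variables (k : comPzRingType) (A B : kalgebra k) (iota : {rmorphism B -> A}).

Notation AA := (ext_tensor iota).
Notation "x ⊗B y" := (@tens _ _ _ (ext_bimod iota) (ring_bimod iota iota) x y : AA)
  (at level 40, left associativity).

(** The test functions: left B-linear additive endomorphisms of A. *)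
Record left_endo := LeftEndo {
  lendo :> A -> A;
  lendoD : {morph lendo : x y / x + y};
  lendoZ : forall b x, lendo (iota b * x) = iota b * lendo x
}.

Program Definition lendo_id := @LeftEndo id _ _.
Next Obligation. by []. Qed.
Next Obligation. by []. Qed.

Program Definition lendo_comp (f g : left_endo) := @LeftEndo (fun x => f (g x)) _ _.
Next Obligation. by move=> f g x y /=; rewrite !lendoD. Qed.
Next Obligation. by move=> f g b x /=; rewrite !lendoZ. Qed.

Program Definition lendo_mulr (a : A) := @LeftEndo (fun x => x * a) _ _.
Next Obligation. by move=> a x y /=; rewrite mulrDl. Qed.
Next Obligation. by move=> a b x /=; rewrite mulrA. Qed.

(** v |-> v^1 f(v^2) *)
Definition contract (f : left_endo) : AA -> A :=
  tlift (fun (x : ext_bimod iota) (y : ring_bimod iota iota) => (x : A) * f y).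

Lemma balanced_contract (f : left_endo) :
  balanced (fun (x : ext_bimod iota) (y : ring_bimod iota iota) => (x : A) * f y).
Proof.
split=> [y x x'|x y y'|x b y] /=; first exact: mulrDl.
- by rewrite lendoD mulrDr.
- by rewrite ring_ractE ring_lactE lendoZ mulrA.
Qed.

Lemma contractE f x y : contract f (x ⊗B y) = x * f y.
Proof. exact: tlift_tens (balanced_contract f). Qed.
Lemma contractB f : {morph contract f : u v / u - v}.
Proof. exact: tliftB (balanced_contract f). Qed.
Lemma contractD f : {morph contract f : u v / u + v}.
Proof. exact: tliftD (balanced_contract f). Qed.

(** v |-> v^1 ⊗ f(v^2) *)
Definition rmap (f : left_endo) : AA -> AA :=
  tmap (fun x : ext_bimod iota => x) (f : ring_bimod iota iota -> ring_bimod iota iota).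

Lemma balanced_rmap (f : left_endo) :
  balanced (fun (x : ext_bimod iota) (y : ring_bimod iota iota) => x ⊗B f y).
Proof. by apply: balanced_tmap => //; [apply: lendoD|apply: lendoZ]. Qed.

Lemma rmapE f x y : rmap f (x ⊗B y) = x ⊗B f y.
Proof. exact: tlift_tens (balanced_rmap f). Qed.
Lemma rmapB f : {morph rmap f : u v / u - v}.
Proof. exact: tliftB (balanced_rmap f). Qed.
Lemma rmapD f : {morph rmap f : u v / u + v}.
Proof. exact: tliftD (balanced_rmap f). Qed.

Lemma AA_lactE a x y : a *:l (x ⊗B y) = (a * x) ⊗B y.
Proof. exact: tensor_lactE. Qed.
Lemma AA_ractE x y b : (x ⊗B y) *:r b = x ⊗B (y * iota b).
Proof. exact: tensor_ractE. Qed.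

Lemma AA_ext (P : zmodType) (f g : AA -> P) :
  {morph f : u v / u - v} -> {morph g : u v / u - v} ->
  (forall x y, f (x ⊗B y) = g (x ⊗B y)) -> f =1 g.
Proof. exact: tlift_ext. Qed.

Lemma contract_lact f a v : contract f (a *:l v) = a * contract f v.
Proof.
move: v; apply: AA_ext => [u v|u v|x y].
- by rewrite lactB contractB.
- by rewrite contractB mulrBr.
- by rewrite AA_lactE !contractE mulrA.
Qed.

Lemma rmap_lact f a v : rmap f (a *:l v) = a *:l rmap f v.
Proof.
move: v; apply: AA_ext => [u v|u v|x y].
- by rewrite lactB rmapB.
- by rewrite rmapB lactB.
- by rewrite AA_lactE !rmapE AA_lactE.
Qed.

Lemma contract_rmap f g v : contract f (rmap g v) = contract (lendo_comp f g) v.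
Proof.
move: v; apply: AA_ext => [u v|u v|x y]; rewrite ?(rmapB, contractB) //.
by rewrite rmapE !contractE.
Qed.

Lemma rmap_comp f g v : rmap f (rmap g v) = rmap (lendo_comp f g) v.
Proof.
move: v; apply: AA_ext => [u v|u v|x y]; rewrite ?rmapB //.
by rewrite !rmapE.
Qed.

(** The right A-action on A ⊗_B A, which as a bimodule only carries its
    restriction to B. *)
Definition rscale (v : AA) (a : A) : AA := rmap (lendo_mulr a) v.

Lemma rscaleE x y a : rscale (x ⊗B y) a = x ⊗B (y * a).
Proof. by rewrite /rscale rmapE. Qed.
Lemma rscaleDr v : {morph rscale v : a b / a + b}.
Proof.
move=> a b; move: v; apply: AA_ext => [u v|u v|x y].
- by rewrite /rscale rmapB.
- by rewrite /rscale !rmapB addrACA opprD.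
- by rewrite !rscaleE mulrDr; apply: (@tensDr _ _ _ _ (ring_bimod iota iota)).
Qed.
Lemma rscaleM v a b : rscale v (a * b) = rscale (rscale v a) b.
Proof.
move: v; apply: AA_ext => [u v|u v|x y]; rewrite ?/rscale ?rmapB //.
by rewrite !rmapE /= mulrA.
Qed.
Lemma rscale1 v : rscale v 1 = v.
Proof.
move: v; apply: AA_ext => [u v|//|x y]; first exact: rmapB.
by rewrite rscaleE mulr1.
Qed.
Lemma rscale_iota v b : rscale v (iota b) = v *:r b.
Proof. by []. Qed.
Lemma rscale_lact a v b : rscale (a *:l v) b = a *:l rscale v b.
Proof. exact: rmap_lact. Qed.

Definition centralizes : pred AA := fun t => `[< forall b, iota b *:l t = t *:r b >].

Lemma centralizes_closed : zmod_closed centralizes.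
Proof.
split=> [|u v]; rewrite ?unfold_in.
  by apply/asboolP => b; rewrite (@lact0 _ _ AA) (@ract0 _ _ AA).
by move=> /asboolP uC /asboolP vC; apply/asboolP => b; rewrite lactB ractB uC vC.
Qed.
HB.instance Definition _ := GRing.isZmodClosed.Build AA centralizes centralizes_closed.

Record central_tensor := CentralTensor { ctval : AA; _ : centralizes ctval }.
HB.instance Definition _ := [isSub for ctval].
HB.instance Definition _ := [Choice of central_tensor by <:].
HB.instance Definition _ := [SubChoice_isSubZmodule of central_tensor by <:].

Lemma ctvalB : {morph ctval : x y / x - y}.
Proof. exact: (raddfB (val : {additive central_tensor -> AA})). Qed.
Lemma ctvalD : {morph ctval : x y / x + y}.
Proof. exact: (raddfD (val : {additive central_tensor -> AA})). Qed.
Lemma ctvalP (t : central_tensor) b : iota b *:l ctval t = ctval t *:r b.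
Proof. by case: t => t /= /asboolP /(_ b). Qed.
Lemma ctval_inj : injective ctval. Proof. exact: val_inj. Qed.

Implicit Types t u : central_tensor.

Lemma rscale_ctval t b y :
  rscale (ctval t) (iota b * y) = iota b *:l rscale (ctval t) y.
Proof. by rewrite -rscale_lact ctvalP -rscale_iota rscaleM. Qed.

(** v |-> v^1 t v^2, well defined because t commutes with B.  It is the
    A-A-bimodule endomorphism of A ⊗_B A that sends 1 ⊗ 1 to t, and the product
    of T is the composition of these endomorphisms. *)
Definition insert t : AA -> AA :=
  tlift (fun (x : ext_bimod iota) (y : ring_bimod iota iota) =>
           (x : A) *:l rscale (ctval t) y).

Lemma balanced_insert t :
  balanced (fun (x : ext_bimod iota) (y : ring_bimod iota iota) =>
           (x : A) *:l rscale (ctval t) y).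
Proof.
split=> [y x x'|x y y'|x b y] /=; first exact: (@lactDl _ _ AA _ x x').
- by rewrite rscaleDr lactDr.
- by rewrite ring_ractE ring_lactE rscale_ctval lactA.
Qed.

Lemma insertE t x y : insert t (x ⊗B y) = x *:l rscale (ctval t) y.
Proof. exact: tlift_tens (balanced_insert t). Qed.
Lemma insertB t : {morph insert t : u v / u - v}.
Proof. exact: tliftB (balanced_insert t). Qed.
Lemma insertD t : {morph insert t : u v / u + v}.
Proof. exact: tliftD (balanced_insert t). Qed.

Lemma insert_lact t a v : insert t (a *:l v) = a *:l insert t v.
Proof.
move: v; apply: AA_ext => [u v|u v|x y].
- by rewrite lactB insertB.
- by rewrite insertB lactB.
- by rewrite AA_lactE !insertE lactA.
Qed.
Lemma insert_rscale t v a : insert t (rscale v a) = rscale (insert t v) a.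
Proof.
move: v; apply: AA_ext => [u v|u v|x y].
- by rewrite /rscale rmapB insertB.
- by rewrite insertB /rscale rmapB.
- by rewrite rscaleE !insertE rscale_lact rscaleM.
Qed.

(** y |-> t^1 f(t^2 y), the transpose of the insertion of t. *)
Program Definition lendo_twist t (f : left_endo) :=
  @LeftEndo (fun y => contract f (rscale (ctval t) y)) _ _.
Next Obligation. by move=> t f x y /=; rewrite rscaleDr contractD. Qed.
Next Obligation.
move=> t f b x /=.
by rewrite rscale_ctval contract_lact.
Qed.

Lemma lendo_twistE t f y : lendo_twist t f y = contract f (rscale (ctval t) y).
Proof. by []. Qed.

Lemma contract_insert t f v : contract f (insert t v) = contract (lendo_twist t f) v.
Proof.
move: v; apply: AA_ext => [u v|u v|x y].
- by rewrite insertB contractB.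
- by rewrite contractB.
- by rewrite insertE contract_lact contractE.
Qed.

Lemma insert_centralizes t u : centralizes (insert t (ctval u)).
Proof.
apply/asboolP => b.
by rewrite -insert_lact ctvalP -rscale_iota insert_rscale rscale_iota.
Qed.
Definition ctmul t u : central_tensor := CentralTensor (insert_centralizes t u).

Lemma ctone_subproof : centralizes (1 ⊗B 1).
Proof.
apply/asboolP => b; rewrite AA_lactE AA_ractE mul1r mulr1.
have := @tens_bal _ _ _ (ext_bimod iota) (ring_bimod iota iota) 1 b 1.
by rewrite ring_ractE ring_lactE mul1r mulr1.
Qed.
Definition ctone := CentralTensor ctone_subproof.

Lemma insert_ctmul t u v : insert (ctmul t u) v = insert t (insert u v).
Proof.
move: v; apply: AA_ext => [v w|v w|x y]; rewrite ?insertB //.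
by rewrite !insertE insert_lact insert_rscale.
Qed.
Lemma insert_one v : insert ctone v = v.
Proof.
move: v; apply: AA_ext => [v w|//|x y]; first exact: insertB.
by rewrite insertE rscaleE AA_lactE mul1r mulr1.
Qed.

Lemma insertDl v : {morph insert ^~ v : t u / t + u}.
Proof.
move=> t u; move: v; apply: AA_ext => [v w|v w|x y].
- by rewrite insertB.
- by rewrite !insertB addrACA opprD.
- by rewrite !insertE ctvalD /rscale rmapD lactDr.
Qed.

Lemma ctmulA : associative ctmul.
Proof. by move=> t u v; apply: ctval_inj; rewrite /= insert_ctmul. Qed.
Lemma ctmul1t : left_id ctone ctmul.
Proof. by move=> t; apply: ctval_inj; rewrite /= insert_one. Qed.
Lemma ctmult1 : right_id ctone ctmul.
Proof. by move=> t; apply: ctval_inj; rewrite /= insertE rscale1 lact1. Qed.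
Lemma ctmulDl : left_distributive ctmul +%R.
Proof. by move=> t u v; apply: ctval_inj; rewrite ctvalD /= insertDl. Qed.
Lemma ctmulDr : right_distributive ctmul +%R.
Proof. by move=> t u v; apply: ctval_inj; rewrite ctvalD /= insertD. Qed.

HB.instance Definition _ := GRing.Zmodule_isPzRing.Build central_tensor
  ctmulA ctmul1t ctmult1 ctmulDl ctmulDr.

Lemma ctvalM t u : ctval (t * u) = insert t (ctval u). Proof. by []. Qed.
Lemma ctval1 : ctval 1 = 1 ⊗B 1. Proof. by []. Qed.

Definition in_centralizer : pred A := fun a => `[< forall b, iota b * a = a * iota b >].

Lemma in_centralizer_closed : subring_closed in_centralizer.
Proof.
split=> [|x y|x y]; rewrite ?unfold_in.
- by apply/asboolP => b; rewrite mulr1 mul1r.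
- move=> /asboolP xC /asboolP yC; apply/asboolP => b.
  by rewrite mulrBl mulrBr xC yC.
- move=> /asboolP xC /asboolP yC; apply/asboolP => b.
  by rewrite mulrA xC -mulrA yC mulrA.
Qed.
HB.instance Definition _ := GRing.isSubringClosed.Build A in_centralizer in_centralizer_closed.

Record centralizer := Centralizer { cval : A; _ : in_centralizer cval }.
HB.instance Definition _ := [isSub for cval].
HB.instance Definition _ := [Choice of centralizer by <:].
HB.instance Definition _ :=
  GRing.SubChoice_isSubPzRing.Build A in_centralizer centralizer in_centralizer_closed.

Lemma cvalP (r : centralizer) b : iota b * cval r = cval r * iota b.
Proof. by case: r => r /= /asboolP /(_ b). Qed.
Lemma cval_inj : injective cval. Proof. exact: val_inj. Qed.
Lemma cvalB : {morph cval : x y / x - y}.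
Proof. exact: (raddfB (val : {rmorphism centralizer -> A})). Qed.
Lemma cvalM : {morph cval : x y / x * y}.
Proof. exact: (rmorphM (val : {rmorphism centralizer -> A})). Qed.
Lemma cvalD : {morph cval : x y / x + y}.
Proof. exact: (raddfD (val : {rmorphism centralizer -> A})). Qed.
Lemma cval1 : cval 1 = 1.
Proof. exact: (rmorph1 (val : {rmorphism centralizer -> A})). Qed.
HB.instance Definition _ := GRing.isZmodMorphism.Build centralizer A cval cvalB.
HB.instance Definition _ := GRing.isMonoidMorphism.Build centralizer A cval (conj cval1 cvalM).

End ExtensionTensor.

#[local] Notation in_alg := Defs.in_alg.

(** * Depth two quasibases *)

Section Quasibase.
Variables (k : comPzRingType) (A B : kalgebra k) (iota : {rmorphism B -> A}).

(** The i-th component of F v is v^1 γ_i(v^2). *)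
Definition quasibase (I : choiceType) (e : I -> central_tensor iota)
    (F : ext_tensor iota -> bimod_copow I (ext_bimod iota)) : Prop :=
  bimod_hom F /\ forall v, lcomb (fun i => ctval (e i)) (F v) = v.

(** The elements t_i are the images of the basis vectors of A^(I) under the
    retraction; they commute with B since the basis vectors do. *)
Lemma depth_two_quasibase : right_depth_two iota ->
  exists (I : choiceType) (e : I -> central_tensor iota) F, quasibase e F.
Proof.
case=> I /summand_retract [F [G FK]].
have [GD GZl GZr] := bmorP G.
pose single (i : I) : bimod_copow I (ext_bimod iota) := << (1 : A) *g i >>.
have singleE (a : A) i : << a *g i >> = a *:l single i.
  apply/malgP => j; rewrite (copow_lactE (M := ext_bimod iota)) !mcoeffU.
  by case: eqP => _; rewrite ?mulr1n ?mulr0n ring_lactE /= ?mulr1 ?mulr0.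
have singleC b i : iota b *:l single i = single i *:r b.
  apply/malgP => j; rewrite (copow_lactE (M := ext_bimod iota)).
  rewrite (copow_ractE (M := ext_bimod iota)) !mcoeffU.
  by case: eqP => _; rewrite ring_lactE ring_ractE ?mulr1n ?mulr0n
    ?mulr1 ?mul1r ?mulr0 ?mul0r.
have eC i : centralizes (G (single i)).
  by apply/asboolP => b; rewrite -GZl -GZr singleC.
exists I, (fun i => CentralTensor (eC i)), F; split; first exact: bmorP.
move=> v; rewrite -{2}[v]FK {2}[bmor F v]monalgE (morphB_sum (bmorB G)) /lcomb.
by apply: eq_bigr => i _; rewrite singleE GZl.
Qed.

Lemma quasibase_depth_two (I : choiceType) (e : I -> central_tensor iota) F :
  quasibase e F -> right_depth_two iota.
Proof.
case=> F_hom FK; exists I; set N := bimod_copow _ _.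
have G_hom : @bimod_hom _ _ N (ext_tensor iota) (lcomb (fun i => ctval (e i))).
  split=> [g h|a g|g b]; first exact: (morphB_D (lcombB _)).
  - by apply: lcomb_lact => i; apply: (copow_lactE (M := ext_bimod iota)).
  - have sgb : (msupp (g *:r b) `<=` msupp (g : {malg A[I]}))%fset.
      apply/fsubsetP => i; rewrite -!mcoeff_neq0 (copow_ractE (M := ext_bimod iota)).
      by apply: contraNneq => ->; rewrite ract0.
    rewrite (lcombE _ sgb) (morphB_sum (ractB b)); apply: eq_bigr => i _.
    rewrite (copow_ractE (M := ext_bimod iota)) ring_ractE lractA -ctvalP.
    by rewrite lactA.
exact: (@retract_summand _ _ _ _ (BimodMorphism G_hom) (BimodMorphism F_hom)).
Qed.
End Quasibase.

(** * The centralizer R and the ring T = (A ⊗_B A)^B *)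

Section CentralizerAlgebras.
Variables (k : comPzRingType) (A B : kalgebra k) (iota : {rmorphism B -> A}).
Hypothesis iota_base : over_base iota.

Notation "x ⊗B y" := (@tens _ _ _ (ext_bimod iota) (ring_bimod iota iota) x y : ext_tensor iota)
  (at level 40, left associativity).

Lemma in_alg_in_centralizer c : in_centralizer iota (in_alg A c).
Proof. by apply/asboolP => b; rewrite in_alg_central. Qed.

Definition centralizer_in_alg c := Centralizer (in_alg_in_centralizer c).

Lemma centralizer_in_algB : {morph centralizer_in_alg : x y / x - y}.
Proof.
by apply: morphD_B => x y; apply: cval_inj; rewrite cvalD /= rmorphD.
Qed.
Lemma centralizer_in_algM : monoid_morphism centralizer_in_alg.
Proof.
by split=> [|x y]; apply: cval_inj; rewrite ?cval1 ?cvalM /= ?rmorph1 ?rmorphM.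
Qed.
HB.instance Definition _ :=
  GRing.isZmodMorphism.Build k (centralizer iota) centralizer_in_alg centralizer_in_algB.
HB.instance Definition _ :=
  GRing.isMonoidMorphism.Build k (centralizer iota) centralizer_in_alg centralizer_in_algM.

Program Definition centralizer_kalg : kalgebra k :=
  @KAlgebra k (centralizer iota) centralizer_in_alg _.
Next Obligation. by move=> c a; apply: cval_inj; rewrite !cvalM /= in_alg_central. Qed.

Definition centralizer_incl : {rmorphism centralizer_kalg -> A} := @cval k A B iota.

Lemma centralizer_incl_over_base : over_base centralizer_incl.
Proof. by []. Qed.

Notation Rc := (centralizer iota).

Lemma source_subproof (r : Rc) : centralizes (1 ⊗B cval r).
Proof.
apply/asboolP => b; rewrite AA_lactE AA_ractE -cvalP mulr1.
have := @tens_bal _ _ _ (ext_bimod iota) (ring_bimod iota iota) 1 b (cval r).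
by rewrite ring_ractE ring_lactE mul1r.
Qed.
Definition source (r : Rc) := CentralTensor (source_subproof r).

Lemma target_subproof (r : Rc) : centralizes (cval r ⊗B 1).
Proof.
apply/asboolP => b; rewrite AA_lactE AA_ractE cvalP mul1r.
have := @tens_bal _ _ _ (ext_bimod iota) (ring_bimod iota iota) (cval r) b 1.
by rewrite ring_ractE ring_lactE mulr1.
Qed.
Definition target (r : Rc) := CentralTensor (target_subproof r).

Lemma insert_source r x y : insert (source r) (x ⊗B y) = x ⊗B (cval r * y).
Proof. by rewrite insertE rscaleE AA_lactE mulr1. Qed.
Lemma insert_target r x y : insert (target r) (x ⊗B y) = (x * cval r) ⊗B y.
Proof. by rewrite insertE rscaleE AA_lactE mul1r. Qed.

Lemma sourceB : {morph source : r s / r - s}.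
Proof.
apply: morphD_B => r s; apply: ctval_inj; rewrite ctvalD /=.
exact: (@tensDr _ _ _ (ext_bimod iota) (ring_bimod iota iota)).
Qed.
Lemma targetD : {morph target : r s / r + s}.
Proof.
move=> r s; apply: ctval_inj; rewrite ctvalD /=.
exact: (@tensDl _ _ _ (ext_bimod iota) (ring_bimod iota iota)).
Qed.
Lemma sourceM : monoid_morphism source.
Proof.
split=> [|r s]; apply: ctval_inj; rewrite ?ctvalM ?ctval1 /= ?cval1 //.
by rewrite insert_source.
Qed.
HB.instance Definition _ :=
  GRing.isZmodMorphism.Build Rc (central_tensor iota) source sourceB.
HB.instance Definition _ :=
  GRing.isMonoidMorphism.Build Rc (central_tensor iota) source sourceM.

Lemma target1 : target 1 = 1.
Proof. by apply: ctval_inj. Qed.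
Lemma targetM r s : target (r * s) = target s * target r.
Proof. by apply: ctval_inj; rewrite ctvalM /= insert_target. Qed.
Lemma source_targetC r s : source r * target s = target s * source r.
Proof.
by apply: ctval_inj; rewrite !ctvalM /= insert_source insert_target mulr1 mul1r.
Qed.

(** Scalars come from B, hence can be moved across the tensor sign. *)
Lemma source_in_alg c : source (centralizer_in_alg c) = target (centralizer_in_alg c).
Proof.
apply: ctval_inj; rewrite /= -iota_base.
have := @tens_bal _ _ _ (ext_bimod iota) (ring_bimod iota iota) 1 (in_alg B c) 1.
by rewrite ring_ractE ring_lactE mulr1 mul1r => ->.
Qed.

Lemma source_in_alg_central c (t : central_tensor iota) :
  source (centralizer_in_alg c) * t = t * source (centralizer_in_alg c).
Proof.
apply: ctval_inj; rewrite !ctvalM /= insertE lact1.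
move: (ctval t); apply: AA_ext => [u v|u v|x y].
- exact: insertB.
- exact: rmapB.
- by rewrite insert_source rscaleE /= in_alg_central.
Qed.

Program Definition central_tensor_kalg : kalgebra k :=
  @KAlgebra k (central_tensor iota) (source \o centralizer_in_alg) _.
Next Obligation. exact: source_in_alg_central. Qed.

Definition central_tensor_st : source_target_ring centralizer_kalg :=
  @SourceTargetRing k centralizer_kalg central_tensor_kalg source target
    (fun=> erefl) (fun c => esym (source_in_alg c)) targetD target1 targetM source_targetC.

End CentralizerAlgebras.

(** * Coordinates on T and on M ⊗_R T *)

Section AssociatorAdditive.
Variables (R S U V : pzRingType).
Variables (M : bimodule R S) (N : bimodule S U) (P : bimodule U V).

Lemma tassocB : {morph @tassoc R S U V M N P : u v / u - v}.
Proof.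
have bal p : balanced
    (fun m n => (m ⊗ ((n ⊗ p) : tensor N P) : tensor M (tensor N P))).
  split=> [n m m'|m n n'|m s n].
  - exact: (@tensDl _ _ _ M (tensor N P)).
  - rewrite -(@tensDr _ _ _ M (tensor N P)); congr tens; exact: tensDl.
  - rewrite tens_bal; congr tens; exact: tens_lact.
have balE m n p := tlift_tens m n (bal p).
apply: tliftB; split=> [p u v|u p p'|u s p]; first exact: (tliftD (bal p)).
- move: u; apply: tlift_ext => [u v|u v|m n].
  + exact: (tliftB (bal (p + p'))).
  + by rewrite (tliftB (bal p)) (tliftB (bal p')) addrACA opprD.
  + rewrite !balE -(@tensDr _ _ _ M (tensor N P)); congr tens; exact: tensDr.
- move: u; apply: tlift_ext => [u v|u v|m n].
  + by rewrite (@ractB _ _ (tensor M N)) (tliftB (bal p)).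
  + exact: (tliftB (bal (s *:l p))).
  + rewrite tens_ract !balE; congr tens; exact: tens_bal.
Qed.
End AssociatorAdditive.

Section Coordinates.
Variables (k : comPzRingType) (A B : kalgebra k) (iota : {rmorphism B -> A}).
Variables (I : choiceType) (e : I -> central_tensor iota).
Variable F : ext_tensor iota -> bimod_copow I (ext_bimod iota).
Hypothesis eF : quasibase e F.

Notation "x ⊗B y" := (@tens _ _ _ (ext_bimod iota) (ring_bimod iota iota) x y : ext_tensor iota)
  (at level 40, left associativity).

Lemma coordD : {morph F : u v / u + v}.
Proof. by have [[]] := eF. Qed.
Lemma coordZl a v i : (F (a *:l v))@_i = a * (F v)@_i.
Proof. by have [[_ -> _] _] := eF; rewrite (copow_lactE (M := ext_bimod iota)). Qed.
Lemma coordZr v b i : (F (v *:r b))@_i = (F v)@_i * iota b.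
Proof. by have [[_ _ ->] _] := eF; rewrite (copow_ractE (M := ext_bimod iota)). Qed.
Lemma coordK v : lcomb (fun i => ctval (e i)) (F v) = v.
Proof. by have [_ ->] := eF. Qed.

(** The endomorphism γ_i of the quasibase. *)
Program Definition coord_endo i : left_endo iota :=
  @LeftEndo _ _ _ iota (fun y => (F (1 ⊗B y))@_i) _ _.
Next Obligation.
move=> i x y /=; rewrite -mcoeffD -coordD; congr (F _)@_i.
exact: (@tensDr _ _ _ (ext_bimod iota) (ring_bimod iota iota)).
Qed.
Next Obligation.
move=> i b x /=; rewrite -coordZl AA_lactE mulr1.
have := @tens_bal _ _ _ (ext_bimod iota) (ring_bimod iota iota) 1 b x.
by rewrite ring_ractE ring_lactE mul1r => ->.
Qed.

Lemma coord_endoZr i y b : coord_endo i (y * iota b) = coord_endo i y * iota b.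
Proof. by rewrite /= -coordZr AA_ractE. Qed.

Lemma contract_coord_endo i v : contract (coord_endo i) v = (F v)@_i.
Proof.
move: v; apply: AA_ext => [u v|u v|x y].
- exact: contractB.
- by rewrite (morphD_B coordD) mcoeffB.
- by rewrite contractE /= -coordZl AA_lactE mulr1.
Qed.

Lemma contract_inj u v : (forall f : left_endo iota, contract f u = contract f v) -> u = v.
Proof.
move=> uv; rewrite -[u]coordK -[v]coordK; congr lcomb.
by apply/malgP => i; rewrite -!contract_coord_endo.
Qed.

Lemma contract_centralizer_subproof (f : left_endo iota) (t : central_tensor iota) :
  (forall y b, f (y * iota b) = f y * iota b) ->
  in_centralizer iota (contract f (ctval t)).
Proof.
move=> fR; apply/asboolP => b; rewrite -contract_lact ctvalP.
move: (ctval t); apply: AA_ext => [u v|u v|x y].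
- by rewrite ractB contractB.
- by rewrite contractB mulrBl.
- by rewrite AA_ractE !contractE fR mulrA.
Qed.
(** t^1 γ_i(t^2), which lies in R for t in T. *)
Definition central_coef i t := Centralizer (contract_centralizer_subproof t (coord_endoZr i)).
Lemma cval_coef i t : cval (central_coef i t) = contract (coord_endo i) (ctval t).
Proof. by []. Qed.

Lemma slice_subproof (f : left_endo iota) (t : central_tensor iota) :
  (forall y b, f (y * iota b) = f y * iota b) -> centralizes (rmap f (ctval t)).
Proof.
move=> fR; apply/asboolP => b; rewrite -rmap_lact ctvalP.
move: (ctval t); apply: AA_ext => [u v|u v|x y].
- by rewrite ractB rmapB.
- by rewrite rmapB ractB.
- by rewrite AA_ractE !rmapE AA_ractE fR.
Qed.
(** t^1 ⊗ γ_i(t^2), again an element of T; these are the left tensor factors in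
    the expansion of Δ(t). *)
Definition slice i t := CentralTensor (slice_subproof t (coord_endoZr i)).

Lemma sliceD i : {morph slice i : t u / t + u}.
Proof. by move=> t u; apply: ctval_inj; rewrite ctvalD /= rmapD. Qed.

(** Since 1 ⊗ y = Σ γ_i(y) t_i, applying f to the right factor gives
    f(y) = Σ γ_i(y) (t_i^1 f(t_i^2)); the sets of indices do not depend on f. *)
Lemma rmap_expand v : eventually (fun S : {fset I} => forall f,
  \sum_(i <- S) rscale (rmap (coord_endo i) v) (contract f (ctval (e i))) = rmap f v).
Proof.
move: v; apply: tens_span => [|u v Pu Pv|x y].
- apply: eventually_true => S f; rewrite [RHS](morphB_0 (rmapB f)) big1 // => i _.
  by rewrite (morphB_0 (rmapB _)) [LHS](morphB_0 (rmapB _)).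
- apply: eventually_sub (eventually_and Pu Pv) => S [uE vE] f.
  rewrite [RHS]rmapB -uE -vE -sumrB; apply: eq_bigr => i _.
  by rewrite rmapB [LHS]rmapB.
- exists (msupp (F (1 ⊗B y))) => S sS f.
  have fyE : f y = \sum_(i <- S) coord_endo i y * contract f (ctval (e i)).
    rewrite -[f y]mul1r -contractE -[1 ⊗B y]coordK (lcombE _ sS).
    rewrite (morphB_sum (contractB f)); apply: eq_bigr => i _.
    exact: contract_lact.
  rewrite [RHS]rmapE fyE (@tens_sumr _ _ _ (ext_bimod iota) (ring_bimod iota iota)).
  by apply: eq_bigr => i _; rewrite rmapE rscaleE.
Qed.

Hypothesis iota_base : over_base iota.
Notation Rk := (centralizer_kalg iota).
Notation Tst := (central_tensor_st iota_base).
Notation Tb := (st_bimod Tst).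

Lemma ctval_lact (r : Rk) (t : Tb) : ctval (r *:l t : Tb) = cval r *:l ctval (t : Tb).
Proof. by rewrite [LHS](insertE (t : Tst)) rscale1. Qed.
Lemma ctval_ract (t : Tb) (r : Rk) : ctval (t *:r r : Tb) = rscale (ctval (t : Tb)) (cval r).
Proof. by rewrite [LHS](insertE (t : Tst)) lact1. Qed.

Definition central_coord (t : Tb) : {malg (centralizer iota)[I]} :=
  [malg i in msupp (F (ctval t)) => central_coef i t].

Lemma central_coordE t i : (central_coord t)@_i = central_coef i t.
Proof.
rewrite mcoeffE; case: ifP => // /negbT /mcoeff_outdom Fi0.
by apply: cval_inj; rewrite /= contract_coord_endo Fi0.
Qed.

Lemma central_dual_basis : dual_basis (e : I -> Tb) central_coord.
Proof.
split=> [t u|r t i|t].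
- apply/malgP => i; rewrite mcoeffD !central_coordE; apply: cval_inj.
  by rewrite cvalD !cval_coef ctvalD contractD.
- rewrite !central_coordE; apply: cval_inj; rewrite cvalM.
  by rewrite !cval_coef ctval_lact contract_lact.
- have sS : (msupp (central_coord t) `<=` msupp (F (ctval t)))%fset.
    apply/fsubsetP => i; rewrite -!mcoeff_neq0 central_coordE; apply: contraNneq => Fi0.
    by apply/eqP/cval_inj; rewrite cval_coef contract_coord_endo Fi0.
  apply: ctval_inj; rewrite (lcombE _ sS) (morphB_sum (@ctvalB _ _ _ iota)).
  rewrite -[RHS]coordK; apply: eq_bigr => i _.
  by rewrite ctval_lact central_coordE cval_coef contract_coord_endo.
Qed.

Lemma central_tensor_projective : left_projective Tb.
Proof. exact: dual_basis_projective central_dual_basis. Qed.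

End Coordinates.

Section Evaluation.
Variables (k : comPzRingType) (A B : kalgebra k) (iota : {rmorphism B -> A}).
Hypothesis iota_base : over_base iota.
Variables (I : choiceType) (e : I -> central_tensor iota).
Variable F : ext_tensor iota -> bimod_copow I (ext_bimod iota).
Hypothesis eF : quasibase e F.

Notation "x ⊗B y" := (@tens _ _ _ (ext_bimod iota) (ring_bimod iota iota) x y : ext_tensor iota)
  (at level 40, left associativity).
Notation Rk := (centralizer_kalg iota).
Notation Tst := (central_tensor_st iota_base).
Notation Tb := (st_bimod Tst).
Implicit Types f g : left_endo iota.

(** An embedding of M into an abelian group on which the right action of R
    extends to A.  It is needed because t^1 f(t^2) is in general an element
    of A only; A embeds into itself and T into A ⊗_B A. *)
Record scalar_ext (Q : pzRingType) (M : bimodule Q Rk) := ScalarExt {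
  se_sort :> zmodType;
  se_act : M -> A -> se_sort;
  se_actDl : forall a, {morph se_act^~ a : m n / m + n};
  se_actDr : forall m, {morph se_act m : a b / a + b};
  se_actZ : forall m (r : Rk) a, se_act (m *:r r) a = se_act m (cval r * a);
  se_act_inj : forall m n, se_act m 1 = se_act n 1 -> m = n
}.

Section Ev.
Variables (Q : pzRingType) (M : bimodule Q Rk) (N : scalar_ext M).

(** m ⊗ t |-> m (t^1 f(t^2)) *)
Definition ev f : tensor_zmod M Tb -> N :=
  tlift (fun (m : M) (t : Tb) => se_act N m (contract f (ctval t))).

Lemma balanced_ev f :
  balanced (fun (m : M) (t : Tb) => se_act N m (contract f (ctval t))).
Proof.
split=> [t m n|m t u|m r t]; first exact: se_actDl.
- by rewrite (@ctvalD _ _ _ iota) contractD se_actDr.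
- by rewrite se_actZ ctval_lact contract_lact.
Qed.

Lemma evE f m t : ev f (m ⊗ t) = se_act N m (contract f (ctval t)).
Proof. exact: tlift_tens (balanced_ev f). Qed.
Lemma evB f : {morph ev f : u v / u - v}.
Proof. exact: tliftB (balanced_ev f). Qed.
Lemma evD f : {morph ev f : u v / u + v}.
Proof. exact: tliftD (balanced_ev f). Qed.

Lemma ev_tcoord i w :
  se_act N (tcoord (central_coord eF (iota_base := iota_base)) i w) 1 =
  ev (coord_endo eF i) w.
Proof.
move: w; apply: tlift_ext => [u v|u v|m t].
- by rewrite (tcoordB (central_dual_basis eF iota_base)) (morphD_B (se_actDl N 1)).
- exact: evB.
- rewrite (tcoordE (central_dual_basis eF iota_base)) se_actZ evE central_coordE.
  by rewrite mulr1.
Qed.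

(** For f = γ_i the value of ev is the i-th coordinate. *)
Lemma ev_inj u v : (forall f, ev f u = ev f v) -> u = v.
Proof.
move=> uv; apply: (tcoord_inj (central_dual_basis eF iota_base)) => i.
by apply: (@se_act_inj _ _ N); rewrite !ev_tcoord.
Qed.

Lemma ev_ract f (w : tensor M Tb) (r : Rk) :
  ev f (w *:r r) = ev (lendo_comp f (lendo_mulr iota (cval r))) w.
Proof.
move: w; apply: tlift_ext => [u v|u v|m t].
- by rewrite ractB evB.
- by rewrite evB.
- by rewrite (@tens_ract _ _ _ M Tb) !evE ctval_ract contract_rmap.
Qed.

Definition tensor_slice i : tensor_zmod M Tb -> tensor_zmod M Tb :=
  tmap (fun m : M => m) (slice eF i : Tb -> Tb).

Lemma balanced_slice i :
  balanced (fun (m : M) (t : Tb) => m ⊗ (slice eF i t : Tb)).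
Proof.
apply: balanced_tmap => //; first exact: sliceD.
move=> r t; apply: ctval_inj; rewrite ctval_lact.
by rewrite [LHS](congr1 (rmap _) (ctval_lact _ _)) rmap_lact.
Qed.

Lemma tensor_sliceE i m t : tensor_slice i (m ⊗ t) = m ⊗ (slice eF i t : Tb).
Proof. exact: tlift_tens (balanced_slice i). Qed.
Lemma tensor_sliceB i : {morph tensor_slice i : u v / u - v}.
Proof. exact: tliftB (balanced_slice i). Qed.

Lemma ev_tensor_slice f i w : ev f (tensor_slice i w) = ev (lendo_comp f (coord_endo eF i)) w.
Proof.
move: w; apply: tlift_ext => [u v|u v|m t].
- by rewrite tensor_sliceB evB.
- exact: evB.
- by rewrite tensor_sliceE !evE contract_rmap.
Qed.
End Ev.

Program Definition regular_ext : scalar_ext (ext_bimod (centralizer_incl iota)) :=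
  @ScalarExt _ _ A (fun m a => (m : A) * a) _ _ _ _.
Next Obligation. by move=> a m n /=; rewrite mulrDl. Qed.
Next Obligation. by move=> m a b /=; rewrite mulrDr. Qed.
Next Obligation. by move=> m r a /=; rewrite ring_ractE mulrA. Qed.
Next Obligation. by move=> m n /=; rewrite !mulr1. Qed.

Program Definition central_ext : scalar_ext Tb :=
  @ScalarExt _ Tb (ext_tensor iota) (fun (m : Tb) a => rscale (ctval m) a) _ _ _ _.
Next Obligation. by move=> a m n; apply: rmapD. Qed.
Next Obligation. by move=> m a b /=; rewrite rscaleDr. Qed.
Next Obligation. 
move=> m r a; rewrite [RHS]rscaleM.
by congr rscale; apply: ctval_ract. Qed.
Next Obligation. by move=> m n /=; rewrite !rscale1; apply: ctval_inj. Qed.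

Notation evA := (ev regular_ext).
Notation evT := (ev central_ext).
Notation Ab := (ext_bimod (centralizer_incl iota)).

Lemma evTE f (m t : Tb) :
  evT f (m ⊗ t) = rscale (ctval m) (contract f (ctval t)).
Proof. exact: evE. Qed.

(** * The R-coring T *)

Lemma ev_comul_sum (t : Tb) : eventually (fun S : {fset I} => forall f,
  evT f (\sum_(i <- S) (slice eF i t : Tb) ⊗ (e i : Tb)) = rmap f (ctval t)).
Proof.
apply: eventually_sub (rmap_expand eF (ctval t)) => S SE f.
rewrite (morphB_sum (evB central_ext f)) -SE; apply: eq_bigr => i _.
exact: evE.
Qed.

Lemma comul_exists (t : Tb) :
  exists w : tensor Tb Tb, forall f, evT f w = rmap f (ctval t).
Proof.
by have [S SE] := eventually_ex (ev_comul_sum t); eexists; apply: SE.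
Qed.

Definition ct_comul (t : Tb) : tensor Tb Tb := projT1 (cid (comul_exists t)).

Lemma ev_comul f t : evT f (ct_comul t) = rmap f (ctval t).
Proof. by rewrite /ct_comul; case: cid. Qed.

Lemma comul_expand t : eventually (fun S : {fset I} =>
  ct_comul t = \sum_(i <- S) (slice eF i t : Tb) ⊗ (e i : Tb)).
Proof.
apply: eventually_sub (ev_comul_sum t) => S SE.
by apply: (ev_inj (N := central_ext)) => f; rewrite ev_comul SE.
Qed.

Lemma ct_comulD : {morph ct_comul : t u / t + u}.
Proof.
move=> t u; apply: (ev_inj (N := central_ext)) => f.
by rewrite evD !ev_comul (@ctvalD _ _ _ iota) rmapD.
Qed.

Lemma ct_comul_lact r t : ct_comul (r *:l t) = r *:l ct_comul t.
Proof.
apply: (ev_inj (N := central_ext)) => f.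
rewrite ev_comul ctval_lact rmap_lact -ev_comul.
move: (ct_comul t) => w; apply: esym; move: w; apply: tlift_ext => [u v|u v|m n].
- by rewrite lactB evB.
- by rewrite evB lactB.
- by rewrite tens_lact !evTE ctval_lact rscale_lact.
Qed.

Lemma ct_comul_ract t r : ct_comul (t *:r r) = ct_comul t *:r r.
Proof.
apply: (ev_inj (N := central_ext)) => f.
by rewrite ev_ract !ev_comul ctval_ract rmap_comp.
Qed.

Lemma ct_comul_hom : bimod_hom ct_comul.
Proof. by split; [exact: ct_comulD|exact: ct_comul_lact|exact: ct_comul_ract]. Qed.

(** t |-> t^1 t^2 *)
Definition ct_counit (t : Tb) : Rk :=
  Centralizer (contract_centralizer_subproof t (f := lendo_id iota) (fun _ _ => erefl)).

Lemma cval_counit t : cval (ct_counit t) = contract (lendo_id iota) (ctval t).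
Proof. by []. Qed.

Lemma contract_id_rscale v a :
  contract (lendo_id iota) (rscale v a) = contract (lendo_id iota) v * a.
Proof.
rewrite contract_rmap; move: v; apply: AA_ext => [u v|u v|x y].
- exact: contractB.
- by rewrite contractB mulrBl.
- by rewrite !contractE /= mulrA.
Qed.

Lemma ct_counit_hom : @bimod_hom Rk Rk Tb (regular_bimod Rk) ct_counit.
Proof.
split=> [t u|r t|t r]; apply: cval_inj; rewrite cval_counit.
- by rewrite (@ctvalD _ _ _ iota) contractD cvalD.
- by rewrite ctval_lact contract_lact ring_lactE cvalM.
- by rewrite ctval_ract contract_id_rscale ring_ractE cvalM.
Qed.

(** Contracting ε(t_(1)) t_(2) with f gives the product of the two factors of
    ev f (Δ(t)) = t^1 ⊗ f(t^2), and contractions separate points. *)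
Lemma ct_counitl t : tlift (fun x y : Tb => ct_counit x *:l y) (ct_comul t) = t.
Proof.
have [eD eZl eZr] := ct_counit_hom.
have bal : balanced (fun x y : Tb => ct_counit x *:l y).
  split=> [y x x'|x y y'|x r y]; first by rewrite eD lactDl.
  - by rewrite lactDr.
  - by rewrite eZr ring_ractE lactA.
apply: ctval_inj; apply: (contract_inj eF) => f.
transitivity (contract (lendo_id iota) (evT f (ct_comul t))); last first.
  by rewrite ev_comul contract_rmap.
move: (ct_comul t); apply: tlift_ext => [u v|u v|m n].
- by rewrite (tliftB bal) (@ctvalB _ _ _ iota) contractB.
- by rewrite evB contractB.
- by rewrite (tlift_tens _ _ bal) ctval_lact contract_lact evTE contract_id_rscale.
Qed.

(** The left-hand side, as an element of A ⊗_B A, is ev at the identity. *)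
Lemma ct_counitr t : tlift (fun x y : Tb => x *:r ct_counit y) (ct_comul t) = t.
Proof.
have [eD eZl eZr] := ct_counit_hom.
have bal : balanced (fun x y : Tb => x *:r ct_counit y).
  split=> [y x x'|x y y'|x r y]; first by rewrite ractDl.
  - by rewrite eD ractDr.
  - by rewrite eZl ring_lactE ractA.
apply: ctval_inj; transitivity (evT (lendo_id iota) (ct_comul t)); last first.
  rewrite ev_comul; move: (ctval t); apply: AA_ext => // [u v|x y].
    exact: rmapB.
  exact: rmapE.
move: (ct_comul t); apply: tlift_ext => [u v|u v|m n].
- by rewrite (tliftB bal) (@ctvalB _ _ _ iota).
- exact: (evB central_ext).
- by rewrite (tlift_tens _ _ bal) ctval_ract evTE.
Qed.

(** Expanding Δ in the second factor brings M ⊗ Δ into the form of the other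
    side of coassociativity, a sum of elements x ⊗ t_i with x in M ⊗_R T; only
    the left factors x then remain to be compared. *)
Lemma comul_tmap_expand (Q : pzRingType) (M : bimodule Q Rk) (w : tensor_zmod M Tb) :
  eventually (fun S : {fset I} => tmap (fun m : M => m) ct_comul w =
    tassoc (\sum_(i <- S) (tensor_slice i w : tensor M Tb) ⊗ (e i : Tb))).
Proof.
have bal : balanced (fun (m : M) (t : Tb) => m ⊗ ct_comul t).
  apply: balanced_tmap => //; [exact: ct_comulD|exact: ct_comul_lact].
move: w; apply: tens_span => [|u v Pu Pv|m t].
- apply: eventually_true => S; rewrite [LHS](morphB_0 (tliftB bal)) big1.
    by rewrite (morphB_0 (@tassocB _ _ _ _ M Tb Tb)).
  by move=> i _; rewrite (morphB_0 (tensor_sliceB i)) (@tens0l _ _ _ (tensor M Tb)).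
- apply: eventually_sub (eventually_and Pu Pv) => S [uE vE].
  rewrite [LHS](tliftB bal) [X in X - _]uE [X in _ - X]vE -tassocB -sumrB.
  congr tassoc; apply: eq_bigr => i _.
  by rewrite tensor_sliceB (@tensBl _ _ _ (tensor M Tb)).
- apply: eventually_sub (comul_expand t) => S tE.
  rewrite [LHS](tlift_tens _ _ bal) tE (@tens_sumr _ _ _ M (tensor Tb Tb)).
  rewrite (morphB_sum (@tassocB _ _ _ _ M Tb Tb)); apply: eq_bigr => i _.
  by rewrite tensor_sliceE tassocE.
Qed.

(** Both sides have the value t^1 ⊗ f(γ_i(t^2)) under ev f. *)
Lemma tensor_slice_comul i t : tensor_slice i (ct_comul t) = ct_comul (slice eF i t).
Proof.
apply: (ev_inj (N := central_ext)) => f.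
by rewrite ev_tensor_slice !ev_comul rmap_comp.
Qed.

Lemma ct_comulA t :
  tassoc (tmap ct_comul (fun t => t) (ct_comul t)) =
  tmap (fun t => t) ct_comul (ct_comul t).
Proof.
have bal : balanced (fun t u : Tb => ct_comul t ⊗ u).
  by apply: balanced_tmap => //; [exact: ct_comulD|exact: ct_comul_ract].
have [S [wE ->]] := eventually_ex
  (eventually_and (comul_expand t) (comul_tmap_expand (ct_comul t))).
congr tassoc; rewrite {1}wE [LHS](morphB_sum (tliftB bal)).
apply: eq_bigr => i _.
by rewrite [LHS](tlift_tens _ _ bal) tensor_slice_comul.
Qed.

Definition ct_coring : coring Tb :=
  @Coring Rk Tb ct_comul ct_counit ct_comul_hom ct_counit_hom ct_comulA
    ct_counitl ct_counitr.

End Evaluation.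

(** * The right bialgebroid T and the coaction on A *)

Section Bialgebroid.
Variables (k : comPzRingType) (A B : kalgebra k) (iota : {rmorphism B -> A}).
Hypothesis iota_base : over_base iota.
Variables (I : choiceType) (e : I -> central_tensor iota).
Variable F : ext_tensor iota -> bimod_copow I (ext_bimod iota).
Hypothesis eF : quasibase e F.

Notation "x ⊗B y" := (@tens _ _ _ (ext_bimod iota) (ring_bimod iota iota) x y : ext_tensor iota)
  (at level 40, left associativity).
Notation Rk := (centralizer_kalg iota).
Notation Tst := (central_tensor_st iota_base).
Notation Tb := (st_bimod Tst).
Implicit Types f g : left_endo iota.
Notation evA := (ev (regular_ext iota)).
Notation evT := (ev (central_ext iota_base)).
Notation Ab := (ext_bimod (centralizer_incl iota)).
Notation ct_comul := (@ct_comul _ _ _ _ iota_base _ _ _ eF).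
Notation ct_counit := (@ct_counit _ _ _ _ iota_base).

Lemma st_mul_ctval (t : Tst) (u : Tb) : ctval (st_mul t u) = insert t (ctval u).
Proof. by []. Qed.

Lemma st_mulDr (t : Tst) : {morph @st_mul _ _ Tst t : u v / u + v}.
Proof. exact: mulrDr. Qed.
Lemma st_mul_lact (u : Tst) r (t : Tb) : st_mul u (r *:l t) = r *:l st_mul u t :> Tb.
Proof. exact: mulrA. Qed.
Lemma st_mul_ract (u : Tst) (t : Tb) r : st_mul u (t *:r r) = st_mul u t *:r r :> Tb.
Proof. exact: mulrA. Qed.

Lemma ct_comul1 : ct_comul (1 : Tst) = @tens _ _ _ Tb Tb (1 : Tst) (1 : Tst).
Proof.
apply: (ev_inj eF (N := central_ext iota_base)) => f.
rewrite ev_comul evTE ctval1 rmapE contractE rscaleE.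
by rewrite !mul1r.
Qed.

Lemma ct_counit1 : ct_counit (1 : Tst) = 1.
Proof. by apply: cval_inj; rewrite cval_counit ctval1 contractE mulr1. Qed.

(** Left multiplication by n in the right factor amounts to replacing f by
    y |-> n^1 f(n^2 y). *)
Lemma ev_right_mul (Q : pzRingType) (M : bimodule Q Rk) (N : scalar_ext M)
    f (n : Tst) (w : tensor_zmod M Tb) :
  ev N f (tmap (fun m : M => m) (st_mul n : Tb -> Tb) w) = ev N (lendo_twist n f) w.
Proof.
have bal : balanced (fun (m : M) (t : Tb) => m ⊗ (st_mul n t : Tb)).
  by apply: balanced_tmap => //; [exact: st_mulDr|exact: st_mul_lact].
move: w; apply: tlift_ext => [u v|u v|m t].
- by rewrite [X in ev _ _ X](tliftB bal) evB.
- exact: evB.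
- by rewrite [X in ev _ _ X](tlift_tens _ _ bal) !evE st_mul_ctval contract_insert.
Qed.

Lemma ct_comul_exchange (r : Rk) (t : Tst) :
  tmap (st_mul (src Tst r : Tst) : Tb -> Tb) (fun t => t) (ct_comul t) =
  tmap (fun t => t) (st_mul (tgt Tst r : Tst) : Tb -> Tb) (ct_comul t).
Proof.
apply: (ev_inj eF (N := central_ext iota_base)) => f.
rewrite ev_right_mul ev_comul.
transitivity (insert (source r) (evT f (ct_comul t))).
  have bal : balanced (fun m n : Tb => (st_mul (src Tst r : Tst) m : Tb) ⊗ n).
    by apply: balanced_tmap => //; [exact: st_mulDr|exact: st_mul_ract].
  move: (ct_comul t); apply: tlift_ext => [u v|u v|m n].
  - by rewrite [X in ev _ _ X](tliftB bal) evB.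
  - by rewrite evB insertB.
  - by rewrite [X in ev _ _ X](tlift_tens _ _ bal) !evTE st_mul_ctval insert_rscale.
rewrite ev_comul; move: (ctval t); apply: AA_ext => [u v|u v|x y].
- by rewrite rmapB insertB.
- exact: rmapB.
- by rewrite !rmapE insert_source /= rscaleE contractE mul1r.
Qed.

Lemma ev_tmul_pure f (m n : Tst) (w : tensor_zmod Tb Tb) :
  evT f (tmap (st_mul m : Tb -> Tb) (st_mul n : Tb -> Tb) w) =
  insert m (evT (lendo_twist n f) w).
Proof.
have bal : balanced (fun x y : Tb => (st_mul m x : Tb) ⊗ (st_mul n y : Tb)).
  by apply: balanced_tmap; [exact: st_mulDr|exact: st_mul_ract|exact: st_mulDr|exact: st_mul_lact].
move: w; apply: tlift_ext => [u v|u v|x y].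
- by rewrite [X in ev _ _ X](tliftB bal) evB.
- by rewrite evB insertB.
- by rewrite [X in ev _ _ X](tlift_tens _ _ bal) !evTE !st_mul_ctval insert_rscale contract_insert.
Qed.

(** The value of (m ⊗ n) Δ(u) under ev f is u^1 m (n^1 f(n^2 u^2)), by ev_tmul_pure.
    This expression shows that the product with Δ(u) is balanced in m and n, and
    summing it over Δ(t) yields u^1 (t^1 ⊗ f(t^2 u^2)), the value of Δ(t u). *)
Lemma ct_comulM (t u : Tst) :
  ct_comul (t * u) = tmul (@st_mul _ _ Tst) (@st_mul _ _ Tst) (ct_comul t) (ct_comul u).
Proof.
have pure f (m n : Tst) :
    evT f (tmap (st_mul m : Tb -> Tb) (st_mul n : Tb -> Tb) (ct_comul u)) =
    insert m (rmap (lendo_twist n f) (ctval u)).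
  by rewrite ev_tmul_pure ev_comul.
have bal : balanced (fun m n : Tb =>
    tmap (st_mul (m : Tst) : Tb -> Tb) (st_mul (n : Tst) : Tb -> Tb) (ct_comul u)).
  split=> [n m m'|m n n'|m r n]; apply: (ev_inj eF (N := central_ext iota_base)) => f;
    rewrite ?evD !pure.
  - exact: insertDl.
  - move: (ctval u); apply: AA_ext => [v w|v w|x y].
    + by rewrite rmapB insertB.
    + by rewrite !rmapB !insertB addrACA opprD.
    + rewrite !rmapE !insertE -lactDr -rscaleDr; congr (_ *:l rscale _ _).
      by rewrite !lendo_twistE -contractD -rmapD.
  - move: (ctval u); apply: AA_ext => [v w|v w|x y].
    + by rewrite rmapB insertB.
    + by rewrite rmapB insertB.
    + rewrite !rmapE !insertE ctval_ract -rscaleM; congr (_ *:l rscale _ _).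
      by rewrite !lendo_twistE ctval_lact rscale_lact contract_lact.
apply: (ev_inj eF (N := central_ext iota_base)) => f.
have [S tE] := eventually_ex (comul_expand eF t).
rewrite ev_comul ctvalM /tmul tE [X in ev _ _ X](morphB_sum (tliftB bal)).
rewrite (morphB_sum (evB _ f)).
transitivity (\sum_(i <- S) insert (slice eF i t) (rmap (lendo_twist (e i) f) (ctval u))).
  move: (ctval u); apply: AA_ext => [v w|v w|x y].
  - by rewrite insertB rmapB.
  - by rewrite -sumrB; apply: eq_bigr => i _; rewrite rmapB insertB.
  - rewrite insertE rmap_lact rmap_comp -(ev_comul eF) tE.
    rewrite (morphB_sum (evB _ _)) (morphB_sum (lactB x)); apply: eq_bigr => i _.
    by rewrite evTE rmapE insertE lendo_twistE contract_rmap.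
apply: eq_bigr => i _.
by rewrite [X in ev _ _ X](tlift_tens _ _ bal) pure.
Qed.

Lemma ct_counitM_src (t u : Tst) :
  ct_counit (t * u) = ct_counit ((src Tst (ct_counit t) : Tst) * u).
Proof.
apply: cval_inj; rewrite !cval_counit !ctvalM.
move: (ctval u); apply: AA_ext => [v w|v w|x y]; rewrite ?insertB ?contractB //.
by rewrite insert_source insertE contract_lact contract_id_rscale contractE.
Qed.

Lemma ct_counitM_tgt (t u : Tst) :
  ct_counit (t * u) = ct_counit ((tgt Tst (ct_counit t) : Tst) * u).
Proof.
apply: cval_inj; rewrite !cval_counit !ctvalM.
move: (ctval u); apply: AA_ext => [v w|v w|x y]; rewrite ?insertB ?contractB //.
by rewrite insert_target insertE contract_lact contract_id_rscale contractE mulrA.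
Qed.

Definition ct_bialgebroid : right_bialgebroid Rk :=
  @RightBialgebroid k Rk Tst (ct_coring iota_base eF) ct_comul1 ct_counit1
    ct_comul_exchange ct_comulM ct_counitM_src ct_counitM_tgt.

(** δ(a) = Σ γ_i(a) ⊗ t_i, because Σ γ_i(a) t_i = 1 ⊗ a. *)
Lemma ev_coact_sum (a : A) : eventually (fun S : {fset I} => forall f,
  evA f (\sum_(i <- S) (coord_endo eF i a : Ab) ⊗ (e i : Tb)) = f a).
Proof.
apply: eventually_sub (rmap_expand eF (1 ⊗B a)) => S SE f.
rewrite (morphB_sum (evB _ f)).
have := congr1 (contract (lendo_id iota)) (SE f).
rewrite rmapE contractE mul1r /= => <-.
rewrite (morphB_sum (contractB _)); apply: eq_bigr => i _.
by rewrite evE contract_id_rscale rmapE contractE mul1r.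
Qed.

Lemma coact_exists (a : A) : exists w : tensor Ab Tb, forall f, evA f w = f a.
Proof.
by have [S SE] := eventually_ex (ev_coact_sum a); eexists; apply: SE.
Qed.

Definition ct_coact (a : A) : tensor Ab Tb := projT1 (cid (coact_exists a)).

Lemma ev_coact f a : evA f (ct_coact a) = f a.
Proof. by rewrite /ct_coact; case: cid. Qed.

Lemma evAE f (a : Ab) (t : Tb) : evA f (a ⊗ t) = (a : A) * contract f (ctval t).
Proof. exact: evE. Qed.

Lemma coact_expand a : eventually (fun S : {fset I} =>
  ct_coact a = \sum_(i <- S) (coord_endo eF i a : Ab) ⊗ (e i : Tb)).
Proof.
apply: eventually_sub (ev_coact_sum a) => S SE.
by apply: (ev_inj eF (N := regular_ext iota)) => f; rewrite ev_coact SE.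
Qed.

Lemma evA_lact f a (w : tensor Ab Tb) : evA f (a *:l w) = a * evA f w.
Proof.
move: w; apply: tlift_ext => [u v|u v|m n].
- by rewrite lactB evB.
- by rewrite evB mulrBr.
- by rewrite tens_lact !evAE ring_lactE mulrA.
Qed.

Lemma ct_coactD : {morph ct_coact : x y / x + y}.
Proof.
move=> x y; apply: (ev_inj eF (N := regular_ext iota)) => f.
by rewrite evD !ev_coact lendoD.
Qed.

Lemma ct_coactZ a (r : Rk) : ct_coact (a * cval r) = ct_coact a *:r r.
Proof.
apply: (ev_inj eF (N := regular_ext iota)) => f.
by rewrite ev_ract !ev_coact.
Qed.

Lemma tensor_slice_coact i a : tensor_slice eF i (ct_coact a) = ct_coact (coord_endo eF i a).
Proof.
apply: (ev_inj eF (N := regular_ext iota)) => f.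
by rewrite ev_tensor_slice !ev_coact.
Qed.

Lemma ct_coactA a :
  tassoc (tmap (ct_coact : Ab -> tensor Ab Tb) (fun t : Tb => t) (ct_coact a)
    : tensor (tensor Ab Tb) Tb) =
  tmap (fun a : Ab => a) ct_comul (ct_coact a).
Proof.
have bal : balanced (fun (x : Ab) (u : Tb) => ct_coact x ⊗ u : tensor (tensor Ab Tb) Tb).
  by apply: balanced_tmap => //; [exact: ct_coactD|exact: ct_coactZ].
have [S [wE ->]] := eventually_ex
  (eventually_and (coact_expand a) (comul_tmap_expand eF (ct_coact a))).
congr tassoc; rewrite {1}wE [LHS](morphB_sum (tliftB bal)).
apply: eq_bigr => i _.
by rewrite [LHS](tlift_tens _ _ bal) tensor_slice_coact.
Qed.

(** The value of (a ⊗ n) δ(y) under ev f is a (n^1 f(n^2 y)), that of a ⊗ n under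
    ev of f composed with right multiplication by y; at δ(x) the latter gives
    f(x y). *)
Lemma ct_coactM x y :
  ct_coact (x * y) = tmul (@coact_mul _ _ _ (centralizer_incl iota))
    (@st_mul _ _ Tst) (ct_coact x) (ct_coact y).
Proof.
pose diag (a : Ab) (n : Tb) :=
  tmap (@coact_mul _ _ _ (centralizer_incl iota) a) (st_mul n : Tb -> Tb) (ct_coact y).
have diag_ev f a n : evA f (diag a n) = evA (lendo_comp f (lendo_mulr iota y)) (a ⊗ n).
  have bal : balanced (fun (b : Ab) (t : Tb) =>
      (coact_mul a b : Ab) ⊗ (st_mul n t : Tb)).
    by apply: balanced_tmap; [exact: mulrDr|move=> b s; exact: mulrA
      |exact: st_mulDr|exact: st_mul_lact].
  rewrite evAE -contract_rmap.
  transitivity ((a : A) * evA (lendo_twist n f) (ct_coact y)); last by rewrite ev_coact.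
  rewrite /diag; move: (ct_coact y); apply: tlift_ext => [u v|u v|b t].
  - by rewrite [X in ev _ _ X](tliftB bal) evB.
  - by rewrite evB mulrBr.
  - rewrite [X in ev _ _ X](tlift_tens _ _ bal) !evAE st_mul_ctval contract_insert.
    by rewrite mulrA.
have bal_diag : balanced diag.
  split=> [n a a'|a n n'|a r n]; apply: (ev_inj eF (N := regular_ext iota)) => f;
    rewrite ?evD !diag_ev -?evD; congr ev.
  - exact: tensDl.
  - exact: tensDr.
  - exact: tens_bal.
apply: (ev_inj eF (N := regular_ext iota)) => f.
rewrite ev_coact -[LHS](ev_coact (lendo_comp f (lendo_mulr iota y))).
rewrite /tmul; move: (ct_coact x); apply: tlift_ext => [u v|u v|a n].
- exact: evB.
- by rewrite [X in ev _ _ X = _](tliftB bal_diag) evB.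
- by rewrite [X in _ = ev _ _ X](tlift_tens _ _ bal_diag) diag_ev.
Qed.

Lemma ct_comodule_algebra :
  @comodule_algebra k Rk ct_bialgebroid A (centralizer_incl iota) ct_coact.
Proof.
split.
- exact: centralizer_incl_over_base.
- exact: ct_coactD.
- exact: ct_coactZ.
- by move=> a; rewrite -[RHS](ev_coact (lendo_id iota) a); congr tlift.
- exact: ct_coactA.
- apply: (ev_inj eF (N := regular_ext iota)) => f.
  by rewrite ev_coact evAE ctval1 contractE !mul1r.
- move=> r a; apply: (ev_inj eF (N := regular_ext iota)) => f.
  rewrite evA_lact ev_right_mul !ev_coact /= rscaleE contractE.
  by rewrite mul1r.
- exact: ct_coactM.
Qed.
End Bialgebroid.

(** * Balanced depth two extensions are Galois *)

Section GaloisFromDepthTwo.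
Variables (k : comPzRingType) (A B : kalgebra k) (iota : {rmorphism B -> A}).
Hypothesis iota_base : over_base iota.
Variables (I : choiceType) (e : I -> central_tensor iota).
Variable F : ext_tensor iota -> bimod_copow I (ext_bimod iota).
Hypothesis eF : quasibase e F.

Notation "x ⊗B y" := (@tens _ _ _ (ext_bimod iota) (ring_bimod iota iota) x y : ext_tensor iota)
  (at level 40, left associativity).
Notation Rk := (centralizer_kalg iota).
Notation Tst := (central_tensor_st iota_base).
Notation Tb := (st_bimod Tst).
Notation Ab := (ext_bimod (centralizer_incl iota)).
Notation evA := (ev (regular_ext iota)).
Notation coact := (@ct_coact _ _ _ _ iota_base _ _ _ eF).

(** For f in End(A_B) and y in A, the map a ⊗ c |-> f(y a) c is defined on
    A ⊗_B A; it takes x ⊗ 1 to f(y x) and 1 ⊗ x to f(y) x. *)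
Lemma balanced_tens_coinvariant (x : A) :
  right_balanced iota -> x ⊗B 1 = 1 ⊗B x -> exists b, x = iota b.
Proof.
move=> bal xE; have [|b bE] := bal (fun y => y * x); last first.
  by exists b; have := bE 1; rewrite !mul1r.
split=> [y z|f [fD fZ] y]; first exact: mulrDl.
pose h := tlift (fun (a : ext_bimod iota) (c : ring_bimod iota iota) => f (y * a) * (c : A)).
have balh : balanced (fun (a : ext_bimod iota) (c : ring_bimod iota iota) => f (y * a) * (c : A)).
  split=> [c a a'|a c c'|a b c].
  - by rewrite mulrDr fD mulrDl.
  - by rewrite mulrDr.
  - by rewrite ring_ractE ring_lactE mulrA fZ mulrA.
have := congr1 h xE; rewrite /h !(tlift_tens _ _ balh) !mulr1.
by move=> <-.
Qed.

Lemma ct_coinvariants : right_balanced iota ->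
  @coinvariants_are_base k Rk (ct_bialgebroid iota_base eF) A (centralizer_incl iota) B iota coact.
Proof.
move=> bal x; split=> [xE|[b ->]].
  apply: balanced_tens_coinvariant => //; apply: (contract_inj eF) => f.
  rewrite !contractE mul1r -[f x](ev_coact iota_base eF) xE evAE ctval1 contractE.
  by rewrite mul1r.
apply: (ev_inj eF (N := regular_ext iota)) => f.
rewrite ev_coact [RHS]evAE ctval1 contractE mul1r -lendoZ mulr1.
by [].
Qed.

Notation can := (canonical_map (T := ct_bialgebroid iota_base eF)
  (iota := iota) (coact : coact_bimod (centralizer_incl iota) -> _)).

Lemma balanced_ct_can : balanced (fun (x : ext_bimod iota) (y : ring_bimod iota iota) =>
  (x : A) *:l coact y).
Proof.
split=> [y x x'|x y y'|x b y].
- exact: (@lactDl _ _ (tensor Ab Tb)).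
- by rewrite ct_coactD lactDr.
- rewrite ring_ractE ring_lactE lactA; congr (_ *:l _).
  apply: (ev_inj eF (N := regular_ext iota)) => f.
  by rewrite evA_lact !ev_coact lendoZ.
Qed.

Lemma ev_can f v : evA f (can v) = contract f v.
Proof.
move: v; apply: AA_ext => [u v|u v|x y].
- by rewrite [X in ev _ _ X](tliftB balanced_ct_can) evB.
- exact: contractB.
- by rewrite [X in ev _ _ X](tlift_tens _ _ balanced_ct_can) evA_lact ev_coact contractE.
Qed.

(** The inverse is a ⊗ t |-> a t: evaluating the canonical map at f gives
    v^1 f(v^2), and so does contracting the inverse. *)
Lemma ct_can_bij : bijective can.
Proof.
have bal : balanced (fun (a : Ab) (t : Tb) => (a : A) *:l ctval t).
  split=> [t a a'|a t u|a r t].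
  - exact: (@lactDl _ _ (ext_tensor iota)).
  - by rewrite (@ctvalD _ _ _ iota) lactDr.
  - by rewrite ring_ractE lactA ctval_lact.
pose mu : tensor Ab Tb -> ext_tensor iota := tlift (fun (a : Ab) (t : Tb) => (a : A) *:l ctval t).
have contract_mu f w : contract f (mu w) = evA f w.
  move: w; apply: tlift_ext => [u v|u v|a t].
  - by rewrite [X in contract _ X](tliftB bal) contractB.
  - exact: (evB (regular_ext iota)).
  - by rewrite [X in contract _ X](tlift_tens _ _ bal) contract_lact evAE.
exists mu => [v|w].
- by apply: (contract_inj eF) => f; rewrite contract_mu ev_can.
- by apply: (ev_inj eF (N := regular_ext iota)) => f; rewrite ev_can contract_mu.
Qed.

Lemma ct_galois : right_balanced iota -> right_galois iota (ct_bialgebroid iota_base eF).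
Proof.
move=> bal; exists (centralizer_incl iota), coact; split.
- exact: ct_comodule_algebra.
- exact: ct_coinvariants.
- exact: ct_can_bij.
Qed.
End GaloisFromDepthTwo.

(** * Galois extensions by projective bialgebroids are balanced of depth two *)

Section DepthTwoFromGalois.
Variables (k : comPzRingType) (A B : kalgebra k) (iota : {rmorphism B -> A}).
Variables (R : kalgebra k) (T : right_bialgebroid R) (j : {rmorphism R -> A}).
Variable delta : coact_bimod j -> coact_tensor T j.
Hypothesis delta_comodule : comodule_algebra delta.
Hypothesis delta_coinv : coinvariants_are_base iota delta.
Hypothesis can_bij : bijective (canonical_map delta : ext_tensor iota -> _).

Variables (I : choiceType) (e : I -> st_bimod T) (f : st_bimod T -> {malg R[I]}).
Hypothesis ef : dual_basis e f.

Notation Ab := (coact_bimod j).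
Notation Tb := (st_bimod T).
Notation AT := (coact_tensor T j).
Notation "a ⊗R t" := (@tens _ _ _ Ab Tb a t : AT) (at level 40, left associativity).
Notation can := (canonical_map delta : ext_tensor iota -> AT).

Lemma delta_iota b : delta (iota b) = iota b ⊗R 1.
Proof. by apply/delta_coinv; exists b. Qed.

(** For b in B, the exchange condition for δ(b) = b ⊗ 1 reads
    r b ⊗ 1 = b ⊗ t_R(r) = b r ⊗ 1; apply the counit. *)
Lemma base_commutes b r : j r * iota b = iota b * j r.
Proof.
have [eD eZ _] := counit_hom (bi_coring T).
have bal : balanced (fun (x : Ab) (t : Tb) => (x : A) * j (counit (bi_coring T) t)).
  split=> [t x x'|x t t'|x s t]; first exact: mulrDl.
  - by rewrite eD rmorphD mulrDr.
  - by rewrite eZ ring_ractE ring_lactE rmorphM mulrA.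
have := coact_exchange delta_comodule r (iota b); rewrite delta_iota.
have balt : balanced (fun (m : Ab) (n : Tb) => m ⊗R (st_mul (tgt T r) n : Tb)).
  by apply: balanced_tmap => // [|s n]; [exact: mulrDr|exact: mulrA].
rewrite tens_lact [RHS](tlift_tens _ _ balt).
have -> : st_mul (tgt T r) 1 = r *:l (1 : Tb) by rewrite /st_mul mulr1 [RHS]mul1r.
rewrite -tens_bal => /(congr1 (tlift (fun (x : Ab) (t : Tb) => (x : A) * j (counit (bi_coring T) t)))).
by rewrite !(tlift_tens _ _ bal) counit1 rmorph1 !mulr1.
Qed.

(** The right B-action a ⊗ t |-> a b ⊗ t, defined because B commutes with R; the
    canonical map is linear for it. *)
Definition base_ract b : AT -> AT := tmap (fun a : Ab => (a : A) * iota b : Ab) (fun t : Tb => t).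

Lemma balanced_base_ract b :
  balanced (fun (a : Ab) (t : Tb) => ((a : A) * iota b) ⊗R t).
Proof.
apply: (balanced_tmap (f := fun a : Ab => (a : A) * iota b : Ab) (g := fun t : Tb => t)) => //.
- by move=> x y; apply: mulrDl.
- by move=> a r; rewrite !ring_ractE -!mulrA base_commutes.
Qed.

Lemma base_ractE b a t : base_ract b (a ⊗R t) = (a * iota b) ⊗R t.
Proof. exact: tlift_tens (balanced_base_ract b). Qed.
Lemma base_ractB b : {morph base_ract b : u v / u - v}.
Proof. exact: tliftB (balanced_base_ract b). Qed.

Lemma base_ract_lact a b w : base_ract b (a *:l w) = a *:l base_ract b w.
Proof.
move: w; apply: tlift_ext => [u v|u v|x t].
- by rewrite lactB base_ractB.
- by rewrite base_ractB lactB.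
- by rewrite tens_lact !base_ractE tens_lact !ring_lactE mulrA.
Qed.

Notation diag a t := (tmap (coact_mul (a : Ab)) (@st_mul _ _ T (t : Tb)) : AT -> AT).

Lemma balanced_diag (a : Ab) (t : Tb) :
  balanced (fun (x : Ab) (y : Tb) => coact_mul a x ⊗R st_mul t y).
Proof.
apply: balanced_tmap.
- exact: mulrDr.
- by move=> x s; apply: mulrA.
- exact: mulrDr.
- by move=> s y; apply: mulrA.
Qed.
Lemma diagE (a : Ab) (t : Tb) x y : diag a t (x ⊗R y) = coact_mul a x ⊗R st_mul t y.
Proof. exact: tlift_tens (balanced_diag a t). Qed.
Lemma diagB (a : Ab) (t : Tb) : {morph diag a t : u v / u - v}.
Proof. exact: tliftB (balanced_diag a t). Qed.

Lemma coact_mulr b y : delta (y * iota b) = base_ract b (delta y).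
Proof.
rewrite (coactM delta_comodule) delta_iota /tmul /base_ract /tmap; congr (tlift _ _).
by apply/funext => a; apply/funext => t; rewrite [LHS]diagE /coact_mul /st_mul mulr1.
Qed.

(** The product with δ(y) is balanced by the exchange condition, so it can be
    evaluated at δ(b) = b ⊗ 1. *)
Lemma coact_mull b y : delta (iota b * y) = iota b *:l delta y.
Proof.
have bal : balanced (fun (a : Ab) (t : Tb) => diag a t (delta y)).
  split=> [t a a'|a t t'|a r t].
  - move: (delta y); apply: tlift_ext => [u v|u v|x z].
    + exact: diagB.
    + by rewrite !diagB addrACA opprD.
    + rewrite !diagE -tensDl; congr (_ ⊗R _); exact: mulrDl.
  - move: (delta y); apply: tlift_ext => [u v|u v|x z].
    + exact: diagB.
    + by rewrite !diagB addrACA opprD.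
    + rewrite !diagE -tensDr; congr (_ ⊗R _); exact: mulrDl.
  - have tgtB : balanced (fun (x : Ab) (z : Tb) => x ⊗R (st_mul (tgt T r) z : Tb)).
      by apply: balanced_tmap => // [|s n]; [exact: mulrDr|exact: mulrA].
    transitivity (diag a t (j r *:l delta y)).
      move: (delta y); apply: tlift_ext => [u v|u v|x z].
      + exact: diagB.
      + by rewrite lactB diagB.
      + rewrite tens_lact !diagE; congr (_ ⊗R _); exact: esym (mulrA _ _ _).
    rewrite (coact_exchange delta_comodule).
    move: (delta y); apply: tlift_ext => [u v|u v|x z].
    + by rewrite [X in diag _ _ X](tliftB tgtB) diagB.
    + exact: diagB.
    + rewrite [X in diag _ _ X](tlift_tens _ _ tgtB) !diagE.
      congr (_ ⊗R _); exact: mulrA.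
rewrite (coactM delta_comodule) delta_iota /tmul (tlift_tens _ _ bal).
move: (delta y); apply: tlift_ext => [u v|u v|x z].
- exact: diagB.
- exact: lactB.
- by rewrite diagE tens_lact /st_mul mul1r.
Qed.

Lemma balanced_can : balanced (fun (x : ext_bimod iota) (y : ring_bimod iota iota) =>
  (x : A) *:l delta y).
Proof.
split=> [y x x'|x y y'|x b y].
- exact: lactDl.
- by rewrite (coactD delta_comodule) lactDr.
- by rewrite ring_ractE ring_lactE coact_mull lactA.
Qed.
Lemma canE (x y : A) :
  can (@tens _ _ _ (ext_bimod iota) (ring_bimod iota iota) x y) = x *:l delta y.
Proof. exact: tlift_tens balanced_can. Qed.
Lemma canB : {morph can : u v / u - v}.
Proof. exact: tliftB balanced_can. Qed.

Lemma can_lact a v : can (a *:l v) = a *:l can v.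
Proof.
move: v; apply: AA_ext => [u v|u v|x y].
- by rewrite lactB canB.
- by rewrite canB lactB.
- by rewrite AA_lactE !canE lactA.
Qed.
Lemma can_ract v b : can (v *:r b) = base_ract b (can v).
Proof.
move: v; apply: AA_ext => [u v|u v|x y].
- by rewrite ractB canB.
- by rewrite canB base_ractB.
- by rewrite AA_ractE !canE coact_mulr base_ract_lact.
Qed.

Lemma tcoord_lact i a (w : AT) : tcoord f i (a *:l w) = a * tcoord f i w :> A.
Proof.
move: w; apply: tlift_ext => [u v|u v|x t].
- by rewrite lactB (tcoordB ef).
- by rewrite (tcoordB ef) mulrBr.
- by rewrite tens_lact !(tcoordE ef) lractA.
Qed.
Lemma tcoord_base_ract i b (w : AT) :
  tcoord f i (base_ract b w) = tcoord f i w * iota b :> A.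
Proof.
move: w; apply: tlift_ext => [u v|u v|x t].
- by rewrite base_ractB (tcoordB ef).
- by rewrite (tcoordB ef) mulrBl.
- by rewrite base_ractE !(tcoordE ef) !ring_ractE -!mulrA base_commutes.
Qed.

(** The quasibase consists of γ_i(y) = y_(0) f_i(y_(1)) and the inverse images of
    the 1 ⊗ t_i, which commute with B because the canonical map is right
    B-linear. *)
Lemma galois_depth_two : right_depth_two iota.
Proof.
have [inv canK invK] := can_bij.
have can_inj := can_inj canK.
have eC i : centralizes (inv (1 ⊗R e i)).
  apply/asboolP => b; apply: can_inj.
  by rewrite can_lact can_ract invK tens_lact base_ractE ring_lactE mulr1 mul1r.
apply: (@quasibase_depth_two _ _ _ iota I (fun i => CentralTensor (eC i))
  (fun v => tcoords f (can v))).
have coeffE v i :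
    @mcoeff I (ext_bimod iota) i (tcoords f (can v)) = tcoord f i (can v).
  exact: (@tcoordsE _ _ _ Ab Tb _ _ _ ef (can v) i).
split=> [|v]; first split=> [u v|a v|v b].
- by apply/malgP => i; rewrite mcoeffD !coeffE (morphB_D canB) (morphB_D (tcoordB ef i)).
- by apply/malgP => i; rewrite (copow_lactE (M := ext_bimod iota)) !coeffE can_lact tcoord_lact.
- by apply/malgP => i; rewrite (copow_ractE (M := ext_bimod iota)) !coeffE can_ract tcoord_base_ract.
apply: can_inj; rewrite [RHS](tcoords_expand ef) (morphB_sum canB).
apply: eq_bigr => i _.
rewrite can_lact invK tens_lact ring_lactE mulr1; congr (_ ⊗R _).
exact: coeffE.
Qed.

(** Here g is right multiplication by c = g(1); commuting with the
    endomorphisms y |-> y_(0) f_i(y_(1)) it makes the coordinates of δ(c) and of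
    c ⊗ 1 agree. *)
Lemma galois_balanced : right_balanced iota.
Proof.
move=> g [gD gE]; pose c := g 1.
have gM x : g x = x * c.
  rewrite -[x in LHS]mulr1 (gE (fun y => x * y)) //.
  by split=> [y z|y b]; rewrite ?mulrDr ?mulrA.
have cR r : j r * c = c * j r.
  rewrite -gM -[j r in LHS]mul1r (gE (fun y => y * j r)) //.
  by split=> [y z|y b]; rewrite ?mulrDl // -!mulrA base_commutes.
suff /delta_coinv [b cE] : delta c = c ⊗R 1 by exists b => x; rewrite gM cE.
apply: (tcoord_inj ef) => i.
have := gE (fun y => tcoord f i (delta y)).
rewrite (tcoordE ef) ring_ractE -cR /c => <-; last first.
  split=> [y z|y b]; first by rewrite (coactD delta_comodule) (morphB_D (tcoordB ef i)).
  by rewrite coact_mulr tcoord_base_ract.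
by rewrite gM (coact1 delta_comodule) (tcoordE ef) ring_ractE mul1r.
Qed.
End DepthTwoFromGalois.

Theorem theorem4p1 (k : comPzRingType) (A B : kalgebra k)
    (iota : {rmorphism B -> A}) (iota_over_base : over_base iota) :
  (right_depth_two iota /\ right_balanced iota) <->
  (exists (R : kalgebra k) (T : right_bialgebroid R),
      left_projective (st_bimod T) /\ right_galois iota T).
Proof.
split=> [[/depth_two_quasibase [I [e [F eF]]] bal]|].
  exists (centralizer_kalg iota), (ct_bialgebroid iota_over_base eF); split.
    exact: central_tensor_projective eF _.
  exact: ct_galois.
case=> R [T [/projective_dual_basis [I [e [f ef]]] [j [delta [dC dI dB]]]]].
split; first exact: galois_depth_two dC dI dB _ _ _ ef.
exact: galois_balanced dC dI _ _ _ ef.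
Qed.
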